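(* Let $s\in\mathbb{Z}_+$ and $Q_0\subsetneqq\mathbb{R}^n$ be a cube. (i) If $1<p\le q<\infty$, then $|Q_0|^{\frac1q-\frac1p}jn_{(p,q,s)_{0}}(Q_0)=L^q(Q_0)$ with equivalent norms. (ii) If $p\in(1,\infty)$, then $jn_{(p,p,s)_{0}}(\mathbb{R}^n)=L^p(\mathbb{R}^n)$ with equivalent norms. (iii) If $1<p<q<\infty$, $\alpha\in[0,\frac1p-\frac1q)$ and $f\in jn_{(p,q,s)_{\alpha}}(\mathbb{R}^n)$, then $f=0$ almost everywhere.
   Context: $\mathbb{Z}_+=\{0,1,2,\dots\}$. A cube $Q\subset\mathbb{R}^n$ has edges parallel to the coordinate axes and finite positive side length $\ell(Q)$, and is not necessarily closed; $\ell(\mathbb{R}^n):=\infty$. $\fint_Q f:=\frac1{|Q|}\int_Q f$. Functions are measurable and identified when equal almost everywhere. Below $\mathcal{X}$ is $\mathbb{R}^n$ or a cube $Q_0\subsetneqq\mathbb{R}^n$. $L^q_{\mathrm{loc}}(\mathcal{X})$ is the set of measurable $f$ with $f\mathbf{1}_E\in L^q(\mathcal{X})$ for every bounded $E\subset\mathcal{X}$. For a constant $\lambda\ge0$ and a normed space $\mathbb{X}$, $\lambda\mathbb{X}$ denotes the space $\mathbb{X}$ equipped with $\lambda\|\cdot\|_{\mathbb{X}}$. For $f\in L^1(Q)$, $P^{(s)}_Q(f)$ is the unique polynomial on $Q$ of degree at most $s$ with $\int_Q[f(x)-P^{(s)}_Q(f)(x)]x^\beta\,dx=0$ for all $\beta\in\mathbb{Z}_+^n$,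 $|\beta|\le s$. Fix $c_0\in(0,\ell(\mathcal{X}))$. Let $P^{(s)}_{Q,c_0}(f):=P^{(s)}_Q(f)$ if $\ell(Q)<c_0$ and $P^{(s)}_{Q,c_0}(f):=0$ if $\ell(Q)\ge c_0$. For $p\in(1,\infty)$, $q\in[1,\infty)$, $\alpha\in[0,\infty)$, $jn_{(p,q,s)_\alpha}(\mathcal{X})$ is the set of all $f\in L^q_{\mathrm{loc}}(\mathcal{X})$ with $$\|f\|_{jn_{(p,q,s)_\alpha}(\mathcal{X})}:=\sup\Big[\sum_{j}|Q_j|\Big\{|Q_j|^{-\alpha}\Big[\fint_{Q_j}|f-P^{(s)}_{Q_j,c_0}(f)|^q\Big]^{1/q}\Big\}^p\Big]^{1/p}<\infty,$$ the supremum being over all countable (finite or infinite) collections $\{Q_j\}_j$ of cubes in $\mathcal{X}$ with pairwise disjoint interiors. *)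

(* Defs.v *)
From HB Require Import structures.
From mathcomp Require Import all_boot all_order all_algebra.
From mathcomp Require Import all_classical all_reals all_analysis.
From mathcomp Require mpoly.

Set Implicit Arguments.
Unset Strict Implicit.
Unset Printing Implicit Defensive.

Import Order.TTheory GRing.Theory Num.Theory.
Import numFieldNormedType.Exports.

Local Open Scope classical_set_scope.
Local Open Scope ring_scope.

(* R^n is [n.-tuple R] with the product (= Borel) sigma-algebra. *)
Notation Rn R n := (n.-tuple (measurableTypeR R)).

Section lebesgue_measure_Rn.
Context {R : realType}.

Definition tcons n (x : measurableTypeR R * Rn R n) : Rn R n.+1 :=
  [tuple of x.1 :: x.2].

Lemma measurable_tcons n : measurable_fun [set: _] (@tcons n).
Proof. exact: measurable_cons. Qed.

Lemma tcons_inj n : injective (@tcons n).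
Proof. by move=> [a u] [b v] /(congr1 val)[-> uv]; congr pair; exact: val_inj. Qed.

Definition tuncons n (x : Rn R n.+1) : measurableTypeR R * Rn R n :=
  (thead x, [tuple of behead x]).

Lemma measurable_tuncons n : measurable_fun [set: _] (@tuncons n).
Proof.
apply: measurable_fun_pair; first exact: measurable_tnth.
exact: measurable_behead.
Qed.

Lemma tconsK n : cancel (@tcons n) (@tuncons n).
Proof. by case=> a u; congr pair; exact: val_inj. Qed.

Lemma tunconsK n : cancel (@tuncons n) (@tcons n).
Proof. by move=> x; rewrite /tcons/= [RHS]tuple_eta; exact: val_inj. Qed.

Section cons_measure.
Context n (m : {sigma_finite_measure set (Rn R n) -> \bar R}).

(* The image of the product measure under R * R^n ~ R^(n+1). *)
Definition cons_measure : set (Rn R n.+1) -> \bar R :=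
  pushforward (lebesgue_measure \x m)%E (@tcons n).

Let cons_measure0 : cons_measure set0 = 0%E.
Proof. by rewrite /cons_measure /pushforward preimage_set0 measure0. Qed.

Let cons_measure_ge0 A : (0 <= cons_measure A)%E.
Proof. by rewrite /cons_measure /pushforward measure_ge0. Qed.

Let cons_measure_sigma_additive : semi_sigma_additive cons_measure.
Proof.
move=> F mF tF mUF; rewrite /cons_measure /pushforward preimage_bigcup.
have mtc A : measurable A -> measurable (@tcons n @^-1` A).
  by move=> mA; rewrite -[X in measurable X]setTI; exact: measurable_tcons.
apply: measure_semi_sigma_additive.
- by move=> i; exact: mtc.
- by apply/trivIsetP => i j _ _ ij; rewrite -preimage_setI;
    move/trivIsetP : tF => -> //; rewrite preimage_set0.
- by rewrite -preimage_bigcup; exact: mtc.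
Qed.

HB.instance Definition _ := isMeasure.Build _ _ _ cons_measure
  cons_measure0 cons_measure_ge0 cons_measure_sigma_additive.

Let cons_measure_sigma_finite : sigma_finite setT cons_measure.
Proof.
have /sigma_finiteP[F [TF ndF Foo]] :=
  sigma_finiteT (@lebesgue_measure R : {sigma_finite_measure set _ -> \bar R}).
have /sigma_finiteP[G [TG ndG Goo]] := sigma_finiteT m.
exists (fun k => @tuncons n @^-1` (F k `*` G k)).
  rewrite -preimage_bigcup; apply/esym; rewrite -subTset => x _ /=.
  have [i _ Fi] : (\bigcup_i F i) (tuncons x).1 by rewrite -TF.
  have [j _ Gj] : (\bigcup_i G i) (tuncons x).2 by rewrite -TG.
  exists (maxn i j) => //; split.
    by move: Fi; exact/subsetPset/ndF/leq_maxl.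
  by move: Gj; exact/subsetPset/ndG/leq_maxr.
move=> k; have [mF Fk] := Foo k; have [mG Gk] := Goo k; split.
  rewrite -[X in measurable X]setTI; apply: measurable_tuncons => //.
  exact: measurableX.
rewrite /cons_measure /pushforward (_ : _ @^-1` _ = F k `*` G k); last first.
  by apply/seteqP; split => x; rewrite /preimage /mkset tconsK.
by rewrite product_measure1E// lte_mul_pinfty// ge0_fin_numE.
Qed.

HB.instance Definition _ := Measure_isSigmaFinite.Build _ _ _ cons_measure
  cons_measure_sigma_finite.

End cons_measure.

End lebesgue_measure_Rn.

Fixpoint lebesgue_Rn (R : realType) (n : nat) :
    {sigma_finite_measure set (Rn R n) -> \bar R} :=
  if n is k.+1 then cons_measure (lebesgue_Rn R k) else \d_([tuple] : Rn R 0).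

(* Only the canonical instances: the notations and coercions of [mpoly] clash
   with those of MathComp-Analysis. *)
Import (canonicals) mpoly.

Section jn_space.
Context {R : realType} {n : nat}.
Local Notation mu := (lebesgue_Rn R n).
Implicit Types (f : Rn R n -> R) (X E : set (Rn R n)).

(* The interior for the product topology of R^n. *)
Definition interior_Rn E : set (Rn R n) :=
  [set x | exists2 e : R, 0 < e &
    forall y : Rn R n, (forall i, `|tnth y i - tnth x i| < e) -> E y].

Definition bounded_Rn E :=
  exists M : R, forall x, E x -> forall i, `|tnth x i| <= M.

(* Product of intervals of length [side] starting at the coordinates of
   [corner]; a face belongs to the cube or not as told by the boolean tuples
   ([BSide true a] is the left side of [a], [BSide false a] its right side). *)
Record cube := Cube {
  corner : n.-tuple R;
  side : R;
  side_gt0 : 0 < side;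
  lower_face : n.-tuple bool;
  upper_face : n.-tuple bool }.

Definition cube_set (Q : cube) : set (Rn R n) :=
  [set x | forall i, tnth x i \in
    Interval (BSide (tnth (lower_face Q) i) (tnth (corner Q) i))
             (BSide (~~ tnth (upper_face Q) i) (tnth (corner Q) i + side Q))].
Coercion cube_set : cube >-> set.

Definition vol E : R := fine (mu E).

Definition average E (g : Rn R n -> \bar R) : \bar R :=
  ((vol E)^-1%:E * \int[mu]_(x in E) g x)%E.

Definition Lp_norm (q : R) X f : \bar R :=
  'N[mu]_(q%:E)[EFin \o (f \_ X)]%E.

Definition Lp_space (q : R) X : set (Rn R n -> R) :=
  [set f | f \_ X \in Lfun mu q%:E].

Definition Lp_loc (q : R) X : set (Rn R n -> R) :=
  [set f | measurable_fun X f /\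
    forall E, measurable E -> bounded_Rn E -> E `<=` X ->
      Lp_space q X (f \_ E)].

Definition monomial (b : mpoly.multinom n) (x : Rn R n) : R :=
  \prod_(i < n) tnth x i ^+ mpoly.fun_of_multinom b i.

Definition peval (P : mpoly.mpoly n R) (x : Rn R n) : R :=
  mpoly.meval (tnth x) P.

Definition degree_le (s : nat) (P : mpoly.mpoly n R) :=
  forall b, b \in mpoly.msupp P -> (mpoly.mdeg b <= s)%N.

Definition is_moment_poly (s : nat) E f (P : mpoly.mpoly n R) :=
  degree_le s P /\
  forall b : mpoly.multinom n, (mpoly.mdeg b <= s)%N ->
    (\int[mu]_(x in E) ((f x - peval P x) * monomial b x)%:E = 0)%E.

(* P_Q^(s)(f): the polynomial with the moments of [f] on the cube. It exists
   and is unique when [f] is integrable on the cube; 0 is a junk value. *)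
Definition moment_poly (s : nat) E f : mpoly.mpoly n R :=
  xget 0 [set P | is_moment_poly s E f P].

Definition moment_poly_c (s : nat) (c0 : R) (Q : cube) f : mpoly.mpoly n R :=
  if side Q < c0 then moment_poly s Q f else 0.

Definition oscillation (q : R) (s : nat) (c0 : R) (Q : cube) f : \bar R :=
  (average Q (fun x =>
     (`|f x - peval (moment_poly_c s c0 Q f) x| `^ q)%:E) `^ q^-1)%E.

(* A countable collection of cubes in [X] is a family indexed by [J : set nat];
   it may be finite or empty. *)
Definition cube_family X (J : set nat) (Q : nat -> cube) :=
  (forall j, J j -> Q j `<=` X) /\
  trivIset J (fun j => interior_Rn (Q j)).

Definition jn_sum (p q : R) (s : nat) (alpha c0 : R) (J : set nat)
    (Q : nat -> cube) f : \bar R :=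
  (\esum_(j in J) ((vol (Q j))%:E *
     ((vol (Q j) `^ (- alpha))%:E * oscillation q s c0 (Q j) f) `^ p))%E.

Definition jn_norm (p q : R) (s : nat) (alpha c0 : R) X f : \bar R :=
  ereal_sup [set r | exists (J : set nat) (Q : nat -> cube),
    cube_family X J Q /\ r = (jn_sum p q s alpha c0 J Q f `^ p^-1)%E].

Definition jn_space (p q : R) (s : nat) (alpha c0 : R) X :
    set (Rn R n -> R) :=
  [set f | Lp_loc q X f /\ (jn_norm p q s alpha c0 X f < +oo)%E].

End jn_space.

Arguments cube R n : clear implicits.

(* A space of functions together with its norm; functions are identified when
   equal almost everywhere, a relation that all the spaces below respect. *)
Record normed_space (F R : Type) := NormedSpace {
  carrier : set F;
  space_norm : F -> \bar R }.

Definition jn (R : realType) n (p q : R) (s : nat) (alpha c0 : R)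
    (X : set (Rn R n)) : normed_space (Rn R n -> R) R :=
  NormedSpace (jn_space p q s alpha c0 X) (jn_norm p q s alpha c0 X).

Definition Lp (R : realType) n (q : R) (X : set (Rn R n)) :
    normed_space (Rn R n -> R) R :=
  NormedSpace (Lp_space q X) (Lp_norm q X).

Definition scaled_space (R : realType) F (lambda : R) (S : normed_space F R) :
    normed_space F R :=
  NormedSpace (carrier S) (fun f => (lambda%:E * space_norm S f)%E).

Definition equal_with_norm_bounds (R : realType) F (c C : R)
    (S T : normed_space F R) :=
  carrier S = carrier T /\
  forall f, carrier S f ->
    (c%:E * space_norm T f <= space_norm S f)%E /\
    (space_norm S f <= C%:E * space_norm T f)%E.

(* Main.v *)
(** On a cube [Q], the moment polynomial [P] of [f] satisfies
    [int_Q P^2 = int_Q f P].  All norms on polynomials of bounded degree are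
    comparable on [Q], uniformly in [Q], in the form
    [sup_Q P^2 <= K |Q|^-1 int_Q P^2], so that [|P| <= K |Q|^-1 int_Q |f|] and
    the oscillation of [f] is at most a constant times its [L^q] mean.  Upper
    bounds on the [jn] norm then follow by summing over the cubes, using for
    [p < q] that [v (a/v)^t <= v + a] for [t <= 1]; lower bounds come from
    testing with a single cube of side at least [c0], where the polynomial is
    0.  In case (iii) a single large cube [Q] gives
    [|Q|^(1/p - alpha - 1/q) ||f||_(L^q(Q)) <= ||f||_jn] with a positive
    exponent, and [|Q|] tends to infinity. *)

Require Import Defs.
From mathcomp Require Import all_boot all_order all_algebra.
From mathcomp Require Import all_classical all_reals all_analysis.
From mathcomp Require Import measurable_realfun qpoly.
From mathcomp Require Import ring lra.
From mathcomp Require mpoly.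

Set Implicit Arguments.
Unset Strict Implicit.
Unset Printing Implicit Defensive.

Import Order.TTheory GRing.Theory Num.Theory.
Import numFieldNormedType.Exports.
Import (canonicals) mpoly.

Local Open Scope classical_set_scope.
Local Open Scope ring_scope.

(** * Interpolation bounds for polynomials in one variable *)

(** Lagrange interpolation: the basis polynomial of node [i], evaluated at [y], is a product of [s]
    ratios [(y - x j) / (x i - x j)], each at most [N] in absolute value. *)
Lemma horner_le_sum_nodes (R : realFieldType) (s : nat) (N : R) (x : nat -> R)
    (y : R) (p : {poly R}) :
  injective x -> 0 <= N -> (size p <= s.+1)%N ->
  (forall i j : 'I_s.+1, i != j -> `|y - x j| <= N * `|x i - x j|) ->
  `|p.[y]| <= (\sum_(i < s.+1) `|p.[x i]|) * N ^+ s.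
Proof.
move=> xinj N0 sp xN.
rewrite {1}(lagrange_gen (ltn0Sn s) xinj sp) horner_sum mulr_suml.
apply: (le_trans (ler_norm_sum _ _ _)); apply: ler_sum => i _.
rewrite hornerM hornerC normrM ler_wpM2l ?normr_ge0//.
rewrite lagrangeE// hornerM hornerC !horner_prod -prodfV -big_split/=.
rewrite normr_prod.
have -> : N ^+ s = \prod_(j < s.+1 | j != i) N.
  by rewrite prodr_const cardC1 card_ord.
apply: ler_prod => j ji; rewrite normr_ge0/= !hornerXsubC normrM normfV mulrC.
rewrite ler_pdivrMr; first by apply: xN; rewrite eq_sym.
by rewrite normr_gt0 subr_eq0 (inj_eq xinj) eq_sym.
Qed.

(* The nodes are taken in every second of [2 s + 1] consecutive intervals of
   equal length; if [p] were small somewhere in each of them, interpolation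
   would make it small at [y]. *)
Lemma horner_le_subinterval (R : realFieldType) (s : nat) :
  exists2 K : R, 1 <= K & forall (a l y : R) (p : {poly R}), 0 < l ->
    (size p <= s.+1)%N -> a <= y <= a + l ->
    exists c : R, [/\ a <= c, c + l / K <= a + l &
      forall t, c < t < c + l / K -> `|p.[y]| <= K * `|p.[t]|].
Proof.
(* [N] counts the intervals and also bounds the ratios of distances: all points lie in a segment of
   length [l] and the nodes are at least [l / N] apart. The factor [s.+1 * N ^ s] is the loss in
   interpolating from [s.+1] nodes. *)
pose N : R := (2 * s + 1)%:R; pose K := N * (s.+1%:R * N ^+ s).
have N1 : 1 <= N by rewrite ler1n addn1.
have N0 : 0 < N by apply: lt_le_trans N1.
have B1 : 1 <= s.+1%:R * N ^+ s.
  by rewrite -[leLHS]mulr1 ler_pM// ?ler1n// exprn_ege1.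
have K1 : 1 <= K by rewrite -[leLHS]mulr1 ler_pM.
have K0 : 0 < K by apply: lt_le_trans K1.
exists K => // a l y p l0 sp /andP[ay yl].
pose h := l / N; have h0 : 0 < h by rewrite divr_gt0.
pose c (i : nat) := a + (2 * i)%:R * h.
have ac i : a <= c i by rewrite lerDl mulr_ge0// ltW.
have hK : l / K <= h by rewrite ler_pM2l// lef_pV2// ler_peMr// ltW.
have lE : l = N * h by rewrite /h; field; apply: lt0r_neq0.
have cl i : (i <= s)%N -> c i + l / K <= a + l.
  move=> si; apply: (@le_trans _ _ (c i + h)); first by rewrite lerD2l.
  rewrite /c [in leRHS]lE -addrA lerD2l -[X in _ + X]mul1r -mulrDl ler_pM2r//.
  by rewrite /N natrD lerD2r ler_nat leq_mul2l si orbT.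
apply: contrapT => nex.
have small i : exists t, c i < t < c i + l / K /\
    ((i <= s)%N -> K * `|p.[t]| < `|p.[y]|).
  (* Interpolation takes a sequence of nodes injective on all of [nat]; those beyond [s] are
     midpoints, with no condition on [p]. *)
  have [si|si] := leqP i s; last first.
    exists (c i + (l / K) / 2); split; last by [].
    have : 0 < l / K by rewrite divr_gt0.
    by move=> ?; apply/andP; split; lra.
  apply: contrapT => nt; apply: nex; exists (c i); split=> //.
    exact: cl.
  move=> t tc; rewrite leNgt; apply/negP => pt; apply: nt; exists t.
  by split.
have /choice[x xP] := small.
(* The skipped interval between two chosen ones provides the gap [h]. *)
have xsep i j : (i < j)%N -> h <= x j - x i.
  move=> ij; have [/andP[_ xi] _] := xP i; have [/andP[xj _] _] := xP j.
  have : c i + h + h <= c j.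
    have : ((2 * i)%:R + 2) * h <= (2 * j)%:R * h.
      by rewrite ler_pM2r// -natrD ler_nat addnC -mulnS leq_mul2l.
    by rewrite /c; lra.
  by lra.
have xinj : injective x.
  move=> i j; case: (ltngtP i j) => // ij xij; have := xsep _ _ ij;
    by rewrite xij subrr leNgt h0.
have := @horner_le_sum_nodes R s N x y p xinj (ltW N0) sp.
(* Since [p] is smaller than [|p.[y]| / K] at every node used, the interpolation bound fails; it
   remains to verify its hypothesis on the distances. *)
have -> : `|p.[y]| <= (\sum_(i < s.+1) `|p.[x i]|) * N ^+ s = false.
  apply/negbTE; rewrite -ltNge.
  apply: (@lt_le_trans _ _ ((\sum_(i < s.+1) (`|p.[y]| / K)) * N ^+ s)).
    rewrite ltr_pM2r ?exprn_gt0//; apply: ltr_sum => [|i _].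
      by apply/hasP; exists ord0 => //; rewrite mem_index_enum.
    rewrite ltr_pdivlMr// mulrC; have [_] := xP i; apply; rewrite -ltnS.
    exact: ltn_ord.
  rewrite sumr_const card_ord -mulr_natl mulrAC mulrC.
  rewrite -[leRHS]mulr1 -mulrA ler_wpM2l// mulrC ler_pdivrMr// mul1r.
  by rewrite ler_peMl// (le_trans _ B1).
move=> ne; suff: false by [].
apply: ne => i j ij.
have : h <= `|x i - x j|.
  case: (ltngtP i j) => [/xsep|/xsep|/val_inj e]; last by rewrite e eqxx in ij.
    by move=> xx; rewrite distrC (le_trans xx)// ler_norm.
  by move=> xx; rewrite (le_trans xx)// ler_norm.
move=> /(ler_wpM2l (ltW N0)); apply: le_trans; rewrite -lE.
have [/andP[x1 x2] _] := xP j.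
have := cl j; rewrite -ltnS ltn_ord => /(_ isT) x3; have := ac j => x4.
by rewrite ler_norml; apply/andP; split; lra.
Qed.

(** * Cubes: measure, boundary, and sums over families with disjoint interiors *)

Section cubes.
Context {R : realType}.

(** Splitting a cube into an interval and a cube of one dimension less, with the same side, follows
    the recursion of [lebesgue_Rn] and permits induction on [n]. *)
Definition cube_head n (Q : cube R n.+1) : interval R :=
  Interval (BSide (thead (lower_face Q)) (thead (corner Q)))
           (BSide (~~ thead (upper_face Q)) (thead (corner Q) + side Q)).

Definition cube_tail n (Q : cube R n.+1) : cube R n :=
  Cube [tuple of behead (corner Q)] (side_gt0 Q)
    [tuple of behead (lower_face Q)] [tuple of behead (upper_face Q)].

Lemma tnth_tcons0 n (z : measurableTypeR R * Rn R n) :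
  tnth (tcons z) ord0 = z.1.
Proof. by []. Qed.

Lemma tnth_tcons n (z : measurableTypeR R * Rn R n) (i : 'I_n) :
  tnth (tcons z) (lift ord0 i) = tnth z.2 i.
Proof. by rewrite tnthS. Qed.

Lemma tcons_cube n (Q : cube R n.+1) (z : measurableTypeR R * Rn R n) :
  cube_set Q (tcons z) <->
  z.1 \in cube_head Q /\ cube_set (cube_tail Q) z.2.
Proof.
split=> [Qz|[Q1 Q2] i].
  split=> [|i]; first by have := Qz ord0.
  by have := Qz (lift ord0 i); rewrite tnth_tcons /cube_tail/= !tnth_behead
    (_ : inord i.+1 = lift ord0 i)//; apply: val_inj; rewrite /= inordK ?ltnS.
case: (unliftP ord0 i) => [j ->|->]; last exact: Q1.
have := Q2 j; rewrite tnth_tcons /cube_tail/= !tnth_behead.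
by rewrite (_ : inord j.+1 = lift ord0 j)//; apply: val_inj; rewrite /= inordK ?ltnS.
Qed.

Lemma preimage_tcons_cube n (Q : cube R n.+1) :
  @tcons R n @^-1` (cube_set Q) =
  [set` cube_head Q] `*` (cube_set (cube_tail Q)).
Proof. by apply/seteqP; split=> z /tcons_cube. Qed.

Lemma cube0 (Q : cube R 0) : (cube_set Q) = [set: Rn R 0].
Proof. by apply/seteqP; split=> // x _ []. Qed.

Lemma measurable_cube n (Q : cube R n) : measurable (cube_set Q).
Proof.
elim: n Q => [Q|n IH Q]; first by rewrite cube0.
rewrite (_ : (cube_set Q) = @tuncons R n @^-1` (@tcons R n @^-1` (cube_set Q))).
  rewrite preimage_tcons_cube -[X in measurable X]setTI.
  apply: measurable_tuncons => //; apply: measurableX; last exact: IH.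
  exact: measurable_itv.
by rewrite -comp_preimage; apply/seteqP; split=> x; rewrite /preimage/= tunconsK.
Qed.

Lemma lebesgue_Rn_cube n (Q : cube R n) :
  lebesgue_Rn R n (cube_set Q) = (side Q ^+ n)%:E.
Proof.
elim: n Q => [Q|n IH Q]; first by rewrite cube0 /= diracT expr0.
have -> : lebesgue_Rn R n.+1 (cube_set Q) =
    ((@lebesgue_measure R) \x (lebesgue_Rn R n))%E (@tcons R n @^-1` (cube_set Q)).
  by [].
rewrite preimage_tcons_cube product_measure1E; last 2 first.
- exact: measurable_itv.
- exact: measurable_cube.
rewrite IH /= [X in (X * _)%E](_ : _ = (side Q)%:E) ?exprS//.
rewrite lebesgue_measure_itv /= lte_fin ltrDl side_gt0 -EFinB.
by congr EFin; rewrite addrC addKr.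
Qed.

Lemma vol_cube n (Q : cube R n) : vol (cube_set Q) = side Q ^+ n.
Proof. by rewrite /vol lebesgue_Rn_cube. Qed.

Lemma vol_cube_gt0 n (Q : cube R n) : 0 < vol (cube_set Q).
Proof. by rewrite vol_cube exprn_gt0// side_gt0. Qed.

Lemma itv_closure (a b x : R) (c d : bool) :
  x \in Interval (BSide c a) (BSide d b) -> a <= x <= b.
Proof.
rewrite in_itv/= => /andP[/lteifW -> ].
by case: d => /=; [exact: ltW|].
Qed.

Lemma itv_interior (a b x : R) (c d : bool) :
  a < x < b -> x \in Interval (BSide c a) (BSide d b).
Proof.
move=> /andP[ax xb]; rewrite in_itv/=; apply/andP; split.
  by case: c; rewrite /= ?ltW.
by case: d; rewrite /= ?ltW.
Qed.

Lemma cube_closure n (Q : cube R n) (x : Rn R n) (i : 'I_n) :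
  cube_set Q x -> tnth (corner Q) i <= tnth x i <= tnth (corner Q) i + side Q.
Proof. by move=> /(_ i) /itv_closure. Qed.

Lemma bounded_cube n (Q : cube R n) : bounded_Rn (cube_set Q).
Proof.
exists (\sum_(i < n) `|tnth (corner Q) i| + side Q) => x Qx i.
have Qi : `|tnth (corner Q) i| <= \sum_(i < n) `|tnth (corner Q) i|.
  by rewrite (bigD1 i)//= lerDl sumr_ge0.
have /andP[ax xb] := cube_closure i Qx.
have := side_gt0 Q; have := ler_norm (- tnth (corner Q) i).
have := ler_norm (tnth (corner Q) i).
by rewrite normrN ler_norml => *; apply/andP; split; lra.
Qed.

(** All faces are removed, which costs only a null set. Families with disjoint interiors thereby
    become families of disjoint sets. *)
Definition open_cube n (Q : cube R n) : cube R n :=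
  Cube (corner Q) (side_gt0 Q) (nseq_tuple n false) (nseq_tuple n false).

Lemma open_cubeP n (Q : cube R n) (x : Rn R n) :
  cube_set (open_cube Q) x <->
  forall i, tnth (corner Q) i < tnth x i < tnth (corner Q) i + side Q.
Proof.
by split=> xQ i; have := xQ i; rewrite /open_cube/= !tnth_nseq in_itv.
Qed.

Lemma sub_open_cube n (Q : cube R n) :
  cube_set (open_cube Q) `<=` cube_set Q.
Proof. by move=> x /open_cubeP xQ i; apply: itv_interior. Qed.

Lemma open_cube_interior n (Q : cube R n) :
  cube_set (open_cube Q) `<=` interior_Rn (cube_set Q).
Proof.
move=> x /open_cubeP xQ; pose d i := Num.min (tnth x i - tnth (corner Q) i)
  (tnth (corner Q) i + side Q - tnth x i).
(* The radius is the least distance to a face, capped at 1, so it stays positive even when there are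
   no coordinates. *)
exists (\big[Num.min/1]_(i < n) d i).
  apply/bigmin_gtP; split => // i _; rewrite lt_min !subr_gt0.
  exact: xQ.
move=> y yx; apply: sub_open_cube; apply/open_cubeP => i.
have := lt_le_trans (yx i) (bigmin_le_cond _ _ (isT : predT i)).
rewrite lt_min => /andP[]; rewrite !ltr_norml => /andP[? _] /andP[_ ?].
by apply/andP; split; lra.
Qed.

Lemma lebesgue_Rn_cube_boundary n (Q : cube R n) :
  lebesgue_Rn R n (cube_set Q `\` cube_set (open_cube Q)) = 0%E.
Proof.
rewrite measureD ?setIidr; [|exact: sub_open_cube|exact: measurable_cube..|].
  rewrite [X in (X - _)%E](lebesgue_Rn_cube Q).
  by rewrite [X in (_ - X)%E](lebesgue_Rn_cube (open_cube Q)) subee.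
by rewrite [X in (X < _)%E](lebesgue_Rn_cube Q) ltry.
Qed.

Lemma ge0_integral_open_cube n (Q : cube R n) (g : Rn R n -> \bar R) :
  measurable_fun (cube_set Q) g -> (forall x, cube_set Q x -> (0 <= g x)%E) ->
  (\int[lebesgue_Rn R n]_(x in cube_set Q) g x =
   \int[lebesgue_Rn R n]_(x in cube_set (open_cube Q)) g x)%E.
Proof.
move=> mg g0.
rewrite (ge0_negligible_integral _ _ mg g0 (lebesgue_Rn_cube_boundary Q)).
- by rewrite setDD setIidr//; exact: sub_open_cube.
- by apply: measurableD; exact: measurable_cube.
- exact: measurable_cube.
Qed.

(** Passing to the open cubes leaves every integral unchanged and makes the domains disjoint, so
    countable additivity bounds the sum by the integral over their union, a subset of [X]. *)
Lemma esum_cube_family n (X : set (Rn R n)) (J : set nat) (Q : nat -> cube R n)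
    (g : Rn R n -> \bar R) :
  measurable X -> measurable_fun X g -> (forall x, X x -> (0 <= g x)%E) ->
  cube_family X J Q ->
  (\esum_(j in J) (\int[lebesgue_Rn R n]_(x in cube_set (Q j)) g x) <=
   \int[lebesgue_Rn R n]_(x in X) g x)%E.
Proof.
move=> mX mg g0 [JX Jdisj].
pose F k : set (Rn R n) :=
  if k \in J then cube_set (open_cube (Q k)) else set0.
have mF k : measurable (F k).
  by rewrite /F; case: ifP => // _; exact: measurable_cube.
have FX : \bigcup_k F k `<=` X.
  move=> x [k _]; rewrite /F; case: ifPn => // /set_mem Jk /sub_open_cube.
  exact: JX.
rewrite esum_mkcond (eq_esum (b := fun k =>
    \int[lebesgue_Rn R n]_(x in F k) g x)%E); last first.
  move=> k _; rewrite /F; case: ifPn => [/set_mem Jk|_]; last first.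
    by rewrite integral_set0.
  rewrite ge0_integral_open_cube//.
    by apply: measurable_funS mg => //; exact: JX.
  by move=> x /(JX k Jk); exact: g0.
rewrite -nneseries_esumT; last first.
  by move=> k; apply: integral_ge0 => x Fx; apply/g0/FX; exists k.
rewrite -ge0_integral_bigcup//.
- apply: ge0_subset_integral => //.
  by apply: bigcup_measurable.
- by apply: measurable_funS mg.
- by move=> x /FX; exact: g0.
- move=> i j _ _ [x []]; rewrite /F.
  case: ifPn => // /set_mem Ji Qi; case: ifPn => // /set_mem Jj Qj.
  by apply: Jdisj => //; exists x; split; exact: open_cube_interior.
Qed.

End cubes.

(** * Polynomials in several variables: pointwise values bounded by the mean square *)

Section polynomial_functions.
Context {R : realType}.

(** This form is stable under freezing the first coordinate: its power is absorbed into the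
    coefficient, and exponents may then repeat. *)
Definition monomial_sum n (I : Type) (r : seq I) (c : I -> R)
    (e : I -> 'I_n -> nat) (x : Rn R n) : R :=
  \sum_(m <- r) c m * \prod_(i < n) tnth x i ^+ e m i.

Lemma measurable_monomial n (e : 'I_n -> nat) :
  measurable_fun [set: Rn R n]
    (fun x : Rn R n => \prod_(i < n) (tnth x i : R) ^+ e i).
Proof.
apply: measurable_prod => i _; apply: measurable_funX.
exact: measurable_tnth.
Qed.

Lemma measurable_monomial_sum n I (r : seq I) c (e : I -> 'I_n -> nat) :
  measurable_fun [set: Rn R n] (monomial_sum r c e).
Proof.
apply: measurable_sum => m; apply: measurable_funM; first exact: measurable_cst.
exact: measurable_monomial.
Qed.

(** Tonelli's theorem, carried over to [n.+1] coordinates by the pushforward that defines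
    [lebesgue_Rn]. *)
Lemma ge0_integral_cube_tcons n (Q : cube R n.+1) (g : Rn R n.+1 -> \bar R) :
  measurable_fun setT g -> (forall x, (0 <= g x)%E) ->
  (\int[lebesgue_Rn R n.+1]_(x in cube_set Q) g x =
   \int[@lebesgue_measure R]_(t in [set` cube_head Q])
     \int[lebesgue_Rn R n]_(y in cube_set (cube_tail Q)) g (tcons (t, y)))%E.
Proof.
move=> mg g0.
have -> : (\int[lebesgue_Rn R n.+1]_(x in cube_set Q) g x =
    \int[pushforward ((@lebesgue_measure R) \x (lebesgue_Rn R n))
           (@tcons R n)]_(x in cube_set Q) g x)%E.
  by [].
rewrite (ge0_integral_pushforward (@measurable_tcons R n)); last 3 first.
- exact: measurable_cube.
- exact: measurable_funS mg.
- by [].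
have mX : measurable ([set` cube_head Q] `*` cube_set (cube_tail Q)).
  by apply: measurableX; [exact: measurable_itv|exact: measurable_cube].
rewrite preimage_tcons_cube integral_mkcond fubini_tonelli1; last 2 first.
- apply/(measurable_restrictT _ mX).
  by apply: measurable_funTS; apply: measurableT_comp mg (@measurable_tcons R n).
- by move=> z; apply: erestrict_ge0 => y _; exact: g0.
rewrite [RHS]integral_mkcond; apply: eq_integral => t _.
rewrite /fubini_F [RHS]patchE; case: ifPn => tQ.
  rewrite [RHS]integral_mkcond; apply: eq_integral => y _.
  by rewrite !patchE in_setX tQ.
by rewrite integral0_eq// => y _; rewrite patchE in_setX (negbTE tQ).
Qed.

Lemma measurable_horner (p : {poly R}) :
  measurable_fun [set: measurableTypeR R] (fun x : measurableTypeR R => p.[x]).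
Proof.
rewrite (_ : (fun _ => _) = fun x => \sum_(i < size p) p`_i * x ^+ i); last first.
  by apply/funext => x; rewrite horner_coef.
apply: measurable_sum => i; apply: measurable_funM; first exact: measurable_cst.
exact: measurable_funX.
Qed.

(** On a subinterval of length [l / K] the square of [p] is at least [p.[t] ^+ 2 / K ^+ 2];
    integrating over it alone gives the constant [K ^+ 3]. *)
Lemma horner_sqr_le_integral (s : nat) :
  exists2 K : R, 0 < K & forall (p : {poly R}) (a l t : R) (c d : bool), 0 < l ->
    (size p <= s.+1)%N -> let i := Interval (BSide c a) (BSide d (a + l)) in
    t \in i ->
    ((l * p.[t] ^+ 2)%:E <=
     K%:E * \int[@lebesgue_measure R]_(y in [set` i]) ((p.[y] ^+ 2)%:E))%E.
Proof.
have [K K1 HK] := horner_le_subinterval R s.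
have K0 : 0 < K by exact: lt_le_trans K1.
exists (K ^+ 3); first exact: exprn_gt0.
move=> p a l t c d l0 sp i /itv_closure /(HK _ _ _ _ l0 sp)[b [ab bl pt]].
have mp : measurable_fun setT (fun y : measurableTypeR R => (p.[y] ^+ 2)%:E).
  apply/measurable_EFinP; apply: measurable_funX.
  exact: measurable_horner.
pose J : set R := [set` `]b, b + l / K[].
have mJ : measurable (J : set (measurableTypeR R)) by exact: measurable_itv.
have sub : J `<=` [set` i].
  move=> y; rewrite /J/=; rewrite in_itv/= => /andP[yb ybl]; apply: itv_interior.
  by rewrite (le_lt_trans ab)//= (lt_le_trans ybl).
have : (((l / K) * (p.[t] ^+ 2 / K ^+ 2))%:E <=
    \int[@lebesgue_measure R]_(y in [set` i]) ((p.[y] ^+ 2)%:E))%E.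
  apply: (@le_trans _ _ (\int[@lebesgue_measure R]_(y in J)
      ((p.[y] ^+ 2)%:E))%E); last first.
    apply: ge0_subset_integral => //.
    - exact: measurable_funTS.
    - by move=> y _; rewrite lee_fin sqr_ge0.
  apply: (@le_trans _ _ (\int[@lebesgue_measure R]_(y in J)
      ((p.[t] ^+ 2 / K ^+ 2)%:E))%E).
    rewrite integral_cst//= lebesgue_measure_itv/= lte_fin ltrDl divr_gt0//.
    by rewrite -EFinB addrAC subrr add0r -EFinM mulrC.
  apply: ge0_le_integral => //.
  - by move=> y _; rewrite lee_fin divr_ge0// ?sqr_ge0.
  - exact: measurable_funTS.
  - move=> y; rewrite /J/= in_itv/= => /pt pty.
    rewrite lee_fin ler_pdivrMr ?exprn_gt0// mulrC.
    have : `|p.[t]| ^+ 2 <= (K * `|p.[y]|) ^+ 2.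
      by rewrite lerXn2r// nnegrE mulr_ge0// ltW.
    by rewrite exprMn !real_normK// num_real.
have K30 : (0 <= (K ^+ 3)%:E)%E by rewrite lee_fin exprn_ge0 ?ltW.
move=> /(lee_wpmul2l K30); apply: le_trans; rewrite -EFinM lee_fin.
by rewrite le_eqVlt; apply/orP; left; apply/eqP; field; apply: lt0r_neq0.
Qed.

Lemma monomial_sum_tcons n I (r : seq I) c (e : I -> 'I_n.+1 -> nat)
    (t : R) (y : Rn R n) :
  monomial_sum r c e (tcons (t, y)) =
  monomial_sum r (fun m => c m * t ^+ e m ord0) (fun m i => e m (lift ord0 i)) y.
Proof.
apply: eq_bigr => m _; rewrite big_ord_recl tnth_tcons0 mulrA; congr (_ * _).
by apply: eq_bigr => i _; rewrite tnth_tcons.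
Qed.

(** Induction on the dimension: the one-variable bound is applied along the first axis, then the
    induction hypothesis on each slice. Every coordinate costs a factor [K], whatever the cube and
    the number of monomials. *)
Lemma monomial_sum_sqr_le_integral (s : nat) :
  exists2 K : R, 0 < K & forall n I (r : seq I) c (e : I -> 'I_n -> nat)
      (Q : cube R n) (x : Rn R n),
    (forall m i, (e m i <= s)%N) -> cube_set Q x ->
    ((vol (cube_set Q) * monomial_sum r c e x ^+ 2)%:E <=
     (K ^+ n)%:E * \int[lebesgue_Rn R n]_(y in cube_set Q)
                      ((monomial_sum r c e y ^+ 2)%:E))%E.
Proof.
have [K K0 HK] := horner_sqr_le_integral s.
(* In dimension 0 the cube is a single point of mass 1 and the two sides agree. *)
exists K => //; elim=> [|n IH] I r c e Q x es Qx.
  rewrite vol_cube !expr0 mul1r mul1e cube0 integral_dirac//; last first.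
    apply/measurable_EFinP; apply: measurable_funX.
    exact: measurable_monomial_sum.
  by rewrite diracT mul1e (tuple0 x).
have mF : measurable_fun setT (fun y : Rn R n.+1 => (monomial_sum r c e y ^+ 2)%:E).
  apply/measurable_EFinP; apply: measurable_funX.
  exact: measurable_monomial_sum.
rewrite ge0_integral_cube_tcons//; last by move=> y; rewrite lee_fin sqr_ge0.
have xE : x = tcons (tuncons x) by rewrite tunconsK.
set t := (tuncons x).1; set y := (tuncons x).2.
have [tQ yQ] : t \in cube_head Q /\ cube_set (cube_tail Q) y.
  by apply/tcons_cube; rewrite -xE.
(* The restriction of the sum to the line through [x] parallel to the first axis. *)
pose p : {poly R} := \sum_(m <- r)
  (c m * \prod_(i < n) tnth y i ^+ e m (lift ord0 i)) *: 'X^(e m ord0).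
have pE z : p.[z] = monomial_sum r c e (tcons (z, y)).
  rewrite monomial_sum_tcons /p horner_sum; apply: eq_bigr => m _.
  by rewrite hornerZ hornerXn mulrAC.
have sp : (size p <= s.+1)%N.
  apply: (big_ind (fun q : {poly R} => (size q <= s.+1)%N)) => [|q1 q2 s1 s2|m _].
  - by rewrite size_poly0.
  - by apply: leq_trans (size_polyD _ _) _; rewrite geq_max s1.
  by apply: (leq_trans (size_scale_leq _ _)); rewrite size_polyXn ltnS.
have := HK p _ _ t _ _ (side_gt0 Q) sp tQ; rewrite pE.
rewrite (_ : tcons (t, y) = x); last by rewrite [RHS]xE -surjective_pairing.
set L := (side Q ^+ n)%:E => le1.
have L0 : (0 <= L)%E by rewrite lee_fin exprn_ge0// ltW// side_gt0.
rewrite vol_cube exprS mulrAC mulrC EFinM -/L.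
apply: (le_trans (lee_wpmul2l L0 le1)).
rewrite [K ^+ n.+1]exprS [(K * K ^+ n)%:E]EFinM -[leRHS]muleA [leLHS]muleCA.
rewrite lee_wpmul2l ?lee_fin ?(ltW K0)//.
have mp : measurable_fun [set` cube_head Q]
    (fun y : measurableTypeR R => (p.[y] ^+ 2)%:E).
  apply/measurable_EFinP; apply: measurable_funX.
  by apply: measurable_funTS; exact: measurable_horner.
rewrite -ge0_integralZl//; last by move=> z _; rewrite lee_fin sqr_ge0.
(* Measurability of the slice integrals comes from Tonelli, after extending the integrand by zero
   off the cube in the remaining coordinates. *)
have mG : measurable_fun setT (fun z : measurableTypeR R =>
  \int[lebesgue_Rn R n]_(w in cube_set (cube_tail Q))
     ((monomial_sum r c e (tcons (z, w)) ^+ 2)%:E))%E.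
  rewrite (_ : (fun _ => _) = fubini_F (lebesgue_Rn R n)
    (fun zw : measurableTypeR R * Rn R n =>
      ((fun u => (monomial_sum r c e (tcons u) ^+ 2)%:E) \_
       (setT `*` cube_set (cube_tail Q))) zw)).
    apply: measurable_fun_fubini_tonelli_F.
      have mX : measurable ([set: measurableTypeR R] `*` cube_set (cube_tail Q)).
        by apply: measurableX => //; exact: measurable_cube.
      apply/(measurable_restrictT _ mX).
      by apply: measurable_funTS; apply: measurableT_comp mF (@measurable_tcons R n).
    by move=> u; apply: erestrict_ge0 => v _; rewrite lee_fin sqr_ge0.
  apply/funext => z; rewrite /fubini_F [LHS]integral_mkcond; apply: eq_integral => w _.
  by rewrite !patchE in_setX in_setT.
have Kn0 : (0 <= (K ^+ n)%:E)%E by rewrite lee_fin exprn_ge0 ?ltW.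
rewrite -ge0_integralZl//; last 2 first.
- exact: measurable_funTS.
- by move=> z _; apply: integral_ge0 => w _; rewrite lee_fin sqr_ge0.
apply: ge0_le_integral => //.
- by move=> z _; apply: mule_ge0; [exact: L0|rewrite lee_fin sqr_ge0].
- exact: measurable_funeM.
- by apply: measurable_funeM; exact: measurable_funTS.
- move=> z _; rewrite -EFinM pE monomial_sum_tcons.
  have := IH I r (fun m => c m * z ^+ e m ord0) (fun m i => e m (lift ord0 i)) _ _ _ yQ.
  rewrite vol_cube => /(_ (fun m i => es m (lift ord0 i))) /le_trans; apply.
  rewrite lee_wpmul2l// le_eqVlt; apply/orP; left; apply/eqP.
  by apply: eq_integral => w _; rewrite monomial_sum_tcons.
Qed.

End polynomial_functions.

(** * Moment polynomials and their bound by the mean of [|f|] *)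

Section moment_polynomials.
Context {R : realType} {n : nat}.
Local Notation mu := (lebesgue_Rn R n).
Implicit Types (Q : cube R n) (f : Rn R n -> R) (P : mpoly.mpoly n R).

Lemma bounded_funP (T : Type) (D : set T) (h : T -> R) (M : R) :
  (forall x, D x -> `|h x| <= M) -> [bounded h x | x in D].
Proof.
move=> hM; exists M; split; first exact: num_real.
by move=> y My x Dx; apply: le_trans (ltW My); exact: hM.
Qed.

Lemma bounded_monomial Q (b : mpoly.multinom n) :
  exists M, forall x, cube_set Q x -> `|monomial b x : R| <= M.
Proof.
have [M QM] := bounded_cube Q.
exists (\prod_(i < n) M ^+ mpoly.fun_of_multinom b i) => x Qx.
rewrite normr_prod; apply: ler_prod => i _; rewrite normr_ge0/= normrX.
by rewrite lerXn2r ?nnegrE ?normr_ge0// ?QM// (le_trans _ (QM _ Qx i)).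
Qed.

Lemma peval_sum P (x : Rn R n) :
  peval P x = \sum_(m <- mpoly.msupp P) mpoly.mcoeff m P * monomial m x.
Proof. exact: mpoly.mevalE. Qed.

Lemma peval0 (x : Rn R n) : peval 0 x = 0.
Proof. by rewrite peval_sum mpoly.msupp0 big_nil. Qed.

(* The exponents are truncated so that they are bounded for every multi-index,
   not only for those in the support. *)
Lemma peval_monomial_sum (s : nat) P : degree_le s P ->
  peval P = monomial_sum (mpoly.msupp P) (fun m => mpoly.mcoeff m P)
    (fun m i => minn (mpoly.fun_of_multinom m i) s).
Proof.
move=> Ps; apply/funext => x; rewrite peval_sum.
apply: eq_big_seq => m /Ps ms; congr (_ * _); apply: eq_bigr => i _.
congr (_ ^+ _); apply/esym/minn_idPl; apply: leq_trans ms.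
by rewrite mpoly.mdegE (bigD1 i)//= leq_addr.
Qed.

Lemma measurable_peval P : measurable_fun [set: Rn R n] (peval P).
Proof.
rewrite (_ : peval P = fun x =>
  \sum_(m <- mpoly.msupp P) mpoly.mcoeff m P * monomial m x); last first.
  by apply/funext => x; exact: peval_sum.
apply: measurable_sum => m; apply: measurable_funM; first exact: measurable_cst.
exact: measurable_monomial.
Qed.

Lemma bounded_peval Q P :
  exists M, forall x, cube_set Q x -> `|peval P x| <= M.
Proof.
have /choice[M HM] := bounded_monomial Q.
exists (\sum_(m <- mpoly.msupp P) `|mpoly.mcoeff m P| * M m) => x Qx.
rewrite peval_sum; apply: (le_trans (ler_norm_sum _ _ _)).
by apply: ler_sum => m _; rewrite normrM ler_wpM2l// HM.
Qed.

Lemma integrable_peval Q P : mu.-integrable (cube_set Q) (EFin \o peval P).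
Proof.
have [M HM] := bounded_peval Q P.
apply: measurable_bounded_integrable.
- exact: measurable_cube.
- by rewrite [X in (X < _)%E](lebesgue_Rn_cube Q) ltry.
- exact: measurable_funTS (measurable_peval P).
- exact: bounded_funP HM.
Qed.

Lemma integrable_mul_peval Q f P : mu.-integrable (cube_set Q) (EFin \o f) ->
  mu.-integrable (cube_set Q) (EFin \o (fun x => f x * peval P x)).
Proof.
move=> fi; have [M HM] := bounded_peval Q P.
apply: (integrableMl (measurable_cube Q) fi).
- exact: measurable_funTS (measurable_peval P).
- exact: bounded_funP HM.
Qed.

(** [P] is a combination of monomials of degree at most [s], and [f - P] integrates to zero against
    each of them, hence against [P]. *)
Lemma moment_poly_orthogonal s Q f P :
  mu.-integrable (cube_set Q) (EFin \o f) -> is_moment_poly s (cube_set Q) f P ->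
  \int[mu]_(x in cube_set Q) (peval P x * peval P x) =
  \int[mu]_(x in cube_set Q) (f x * peval P x).
Proof.
move=> fi [Ps Pmom]; have mQ := measurable_cube Q.
have iPP := integrable_mul_peval P (integrable_peval Q P).
have ifP := integrable_mul_peval P fi.
have gi : mu.-integrable (cube_set Q) (EFin \o (fun x => f x - peval P x)).
  rewrite (_ : _ \o _ = (EFin \o f) \- (EFin \o peval P))%E.
    exact: integrableB (integrable_peval Q P).
  by [].
have gmi m : mu.-integrable (cube_set Q)
    (fun x => ((f x - peval P x) * monomial m x)%:E).
  have [M HM] := bounded_monomial Q m.
  apply: (integrableMl mQ gi).
  - exact: measurable_funTS (measurable_monomial _).
  - exact: bounded_funP HM.
apply/eqP; rewrite eq_sym -subr_eq0 -RintegralB//; apply/eqP.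
rewrite /Rintegral (_ : (\int[mu]_(x in cube_set Q) _)%E = 0%E)//.
transitivity (\int[mu]_(x in cube_set Q) \sum_(m <- mpoly.msupp P)
    ((mpoly.mcoeff m P)%:E * ((f x - peval P x) * monomial m x)%:E))%E.
  apply: eq_integral => x _; rewrite -mulrBl {2}peval_sum mulr_sumr -sumEFin.
  by apply: eq_bigr => m _; rewrite -EFinM mulrCA.
rewrite integral_sum//; last by move=> m; exact: integrableZl.
rewrite big_seq big1// => m /Ps ms.
by rewrite integralZl// Pmom// mule0.
Qed.

(** Let [A] be the integral of [P ^ 2], [F] that of [|f|], and [B] the bound on [|P|] given by
    [V * B ^ 2 = K * A]. Orthogonality gives [A <= B * F], so [V * B ^ 2 <= K * B * F], and
    cancelling [B] yields the claim. *)
Lemma norm_moment_poly_le (s : nat) :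
  exists2 K : R, 0 < K & forall Q f P (x : Rn R n),
    mu.-integrable (cube_set Q) (EFin \o f) ->
    is_moment_poly s (cube_set Q) f P -> cube_set Q x ->
    `|peval P x| <= K * ((vol (cube_set Q))^-1 * \int[mu]_(y in cube_set Q) `|f y|).
Proof.
have [K0 K00 HK] := @monomial_sum_sqr_le_integral R s.
pose K := K0 ^+ n; have Kgt0 : 0 < K by exact: exprn_gt0.
exists K => // Q f P x fi Pmom Qx; have mQ := measurable_cube Q.
have V0 := vol_cube_gt0 Q; set V := vol (cube_set Q) in V0 *.
have iPP := integrable_mul_peval P (integrable_peval Q P).
have ifP := integrable_mul_peval P fi.
have iaf : mu.-integrable (cube_set Q) (EFin \o (fun y => `|f y|)).
  exact: integrable_norm.
pose A := \int[mu]_(y in cube_set Q) (peval P y * peval P y).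
pose F := \int[mu]_(y in cube_set Q) `|f y|.
have A0 : 0 <= A by apply: Rintegral_ge0 => y _; rewrite -expr2 sqr_ge0.
have F0 : 0 <= F by apply: Rintegral_ge0.
have PA y : cube_set Q y -> V * peval P y ^+ 2 <= K * A.
  move=> Qy; have [Ps _] := Pmom.
  have := HK n _ (mpoly.msupp P) (fun m => mpoly.mcoeff m P)
    (fun m i => minn (mpoly.fun_of_multinom m i) s) Q y
    (fun m i => geq_minr _ _) Qy.
  rewrite -peval_monomial_sum//.
  suff -> : (\int[mu]_(z in cube_set Q) ((peval P z ^+ 2)%:E) = A%:E)%E.
    by rewrite -EFinM lee_fin.
  by rewrite /A /Rintegral fineK//; exact: integrable_fin_num iPP.
pose B := Num.sqrt (K * A / V).
have B0 : 0 <= B by exact: sqrtr_ge0.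
have BE : V * B ^+ 2 = K * A.
  rewrite sqr_sqrtr; last by rewrite divr_ge0 ?mulr_ge0// ltW.
  by field; exact: lt0r_neq0.
have PB y : cube_set Q y -> `|peval P y| <= B.
  move=> /PA; rewrite -BE ler_pM2l// -(real_normK (num_real (peval P y))).
  by rewrite ler_pXn2r// nnegrE normr_ge0.
have AF : A <= B * F.
  rewrite /A (moment_poly_orthogonal fi Pmom) -RintegralZl//.
  apply: le_Rintegral => //; first exact: (integrableZl mQ B iaf).
  move=> y Qy; apply: (le_trans (ler_norm _)).
  by rewrite normrM mulrC ler_wpM2r// PB.
apply: (le_trans (PB _ Qx)); rewrite -/F mulrCA mulrC ler_pdivlMr// mulrC.
(* One factor [B] is to be cancelled, so it must be nonzero. *)
have [B00|Bn0] := eqVneq B 0; first by rewrite B00 mulr0 mulr_ge0// ltW.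
have Bgt0 : 0 < B by rewrite lt_neqAle eq_sym Bn0.
rewrite -(ler_pM2r Bgt0) -mulrA -expr2 BE -mulrA ler_pM2l//.
by rewrite mulrC.
Qed.

End moment_polynomials.

(** * Oscillations and power means *)

Section oscillation_bounds.
Context {R : realType} {n : nat}.
Local Notation mu := (lebesgue_Rn R n).
Implicit Types (Q : cube R n) (f : Rn R n -> R).

Lemma measurable_norm_powR (D : set (Rn R n)) f (q : R) :
  measurable_fun D f -> measurable_fun D (fun x => `|f x| `^ q).
Proof.
move=> mf; apply: (measurableT_comp (measurable_powR q)).
exact: measurableT_comp.
Qed.

Lemma integrable_norm_powR Q f (q : R) : measurable_fun (cube_set Q) f ->
  (\int[mu]_(x in cube_set Q) (`|f x| `^ q)%:E < +oo)%E ->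
  mu.-integrable (cube_set Q) (EFin \o (fun x => `|f x| `^ q)).
Proof.
move=> mf fq; apply/integrableP; split.
  by apply/measurable_EFinP; exact: measurable_norm_powR.
under eq_integral do rewrite /= ger0_norm ?powR_ge0//.
exact: fq.
Qed.

Lemma integrable_cube_cst Q (c : R) :
  mu.-integrable (cube_set Q) (EFin \o cst c).
Proof.
apply: measurable_bounded_integrable.
- exact: measurable_cube.
- by rewrite [X in (X < _)%E](lebesgue_Rn_cube Q) ltry.
- exact: measurable_cst.
- by apply: (@bounded_funP _ _ _ _ `|c|).
Qed.

Lemma Rintegral_cube_cst Q (c : R) :
  \int[mu]_(x in cube_set Q) c = c * vol (cube_set Q).
Proof. by rewrite Rintegral_cst//; exact: measurable_cube. Qed.

(** If [t > M], then [t / M] exceeds 1 and is at most its [q]-th power; otherwise the first summand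
    suffices. *)
Lemma le_add_powR (M t q : R) : 0 < M -> 0 <= t -> 1 <= q ->
  t <= M + M / M `^ q * t `^ q.
Proof.
move=> M0 t0 q1; have Mq0 : 0 < M `^ q by exact: powR_gt0.
have [tM|Mt] := leP t M; first by rewrite ler_wpDr// mulr_ge0 ?powR_ge0// divr_ge0// ltW.
have -> : t `^ q = (t / M) `^ q * M `^ q.
  by rewrite -powRM ?divr_ge0 ?(ltW M0)// divfK// lt0r_neq0.
rewrite (_ : _ * (_ * _) = (t / M) `^ q * M); last by field; exact: lt0r_neq0.
rewrite ler_wpDl ?(ltW M0)// -ler_pdivrMr//.
by apply: le1r_powR => //; rewrite ler_pdivlMr// mul1r ltW.
Qed.

Lemma integrable_powR Q f (q : R) : 1 <= q -> measurable_fun (cube_set Q) f ->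
  (\int[mu]_(x in cube_set Q) (`|f x| `^ q)%:E < +oo)%E ->
  mu.-integrable (cube_set Q) (EFin \o f).
Proof.
move=> q1 mf fq; have mQ := measurable_cube Q.
have i1 := integrableD mQ (integrable_cube_cst Q 1) (integrable_norm_powR mf fq).
apply: (le_integrable mQ _ _ i1); first exact/measurable_EFinP.
move=> x _ /=; rewrite lee_fin [leRHS]ger0_norm ?addr_ge0 ?powR_ge0//.
by have := le_add_powR ltr01 (normr_ge0 (f x)) q1; rewrite powR1 divr1 mul1r.
Qed.

(* Half of Jensen's inequality: integrate [t <= M + M^(1-q) t^q] with [M]
   slightly above the power mean. *)
Lemma mean_le_power_mean Q f (q : R) : 1 <= q -> measurable_fun (cube_set Q) f ->
  (\int[mu]_(x in cube_set Q) (`|f x| `^ q)%:E < +oo)%E ->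
  (vol (cube_set Q))^-1 * \int[mu]_(x in cube_set Q) `|f x| <=
  2 * ((vol (cube_set Q))^-1 * \int[mu]_(x in cube_set Q) (`|f x| `^ q)) `^ q^-1.
Proof.
move=> q1 mf fq; have mQ := measurable_cube Q.
have V0 := vol_cube_gt0 Q; set V := vol (cube_set Q) in V0 *.
have ifq := integrable_norm_powR mf fq.
have iaf := integrable_norm (integrable_powR q1 mf fq).
set a := \int[mu]_(x in cube_set Q) (`|f x| `^ q).
have a0 : 0 <= a by apply: Rintegral_ge0 => x _; exact: powR_ge0.
have q0 : 0 < q by exact: lt_le_trans q1.
set m := (V^-1 * a) `^ q^-1.
have aM : V^-1 * a = m `^ q.
  by rewrite /m -powRrM mulVf ?lt0r_neq0// powRr1// mulr_ge0// invr_ge0 ltW.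
have m0 : 0 <= m by exact: powR_ge0.
apply/ler_addgt0Pr => e e0.
(* The mean [m] may vanish, while division by [M ^ q] requires [M > 0]; the total error is [e]. *)
pose M := m + e / 2; have M0 : 0 < M by rewrite ltr_wpDl// divr_gt0.
have MqE : V^-1 * a <= M `^ q.
  by rewrite aM ge0_ler_powR ?nnegrE// ?ltW// /M ltrDl divr_gt0.
have -> : 2 * m + e = M + M by rewrite /M; lra.
have Mq0 : 0 < M `^ q by exact: powR_gt0.
apply: (@le_trans _ _ (V^-1 * (M * V + M / M `^ q * a))).
  rewrite ler_wpM2l ?invr_ge0 ?(ltW V0)//.
  rewrite /a -RintegralZl// -Rintegral_cube_cst -RintegralD//; last first.
  - exact: (integrableZl mQ (M / M `^ q) ifq).
  - exact: integrable_cube_cst.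
  apply: le_Rintegral => //.
    exact: (integrableD mQ (integrable_cube_cst Q M)
      (integrableZl mQ (M / M `^ q) ifq)).
  by move=> x _; exact: le_add_powR.
rewrite mulrDr [V^-1 * (M * V)]mulrC mulfK ?lt0r_neq0// lerD2l.
rewrite mulrCA mulrAC -mulrA ger_pMr// ler_pdivrMr// mul1r//.
Qed.

(** On [Q] the polynomial is bounded by [B], which is [2 * K] times the power mean of [f]. Then
    [|f - P| ^ q <= 2 ^ q * (|f| ^ q + B ^ q)], and [B ^ q] integrates to [(2 * K) ^ q] times the
    integral of [|f| ^ q]. The constant depends neither on [c0] nor on [Q]. *)
Lemma oscillation_le (q : R) (s : nat) : 1 <= q ->
  exists2 C : R, 0 < C & forall (c0 : R) Q f, measurable_fun (cube_set Q) f ->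
    (\int[mu]_(x in cube_set Q) (`|f x| `^ q)%:E < +oo)%E ->
    (oscillation q s c0 Q f <= ((C * ((vol (cube_set Q))^-1 *
       \int[mu]_(x in cube_set Q) (`|f x| `^ q))) `^ q^-1)%:E)%E.
Proof.
move=> q1; have [K K0 HK] := @norm_moment_poly_le R n s.
have q0 : 0 < q by exact: lt_le_trans q1.
exists (2 `^ q * (1 + (K * 2) `^ q)).
  by rewrite mulr_gt0 ?powR_gt0// ltr_wpDr ?powR_ge0.
move=> c0 Q f mf fq; have mQ := measurable_cube Q.
have V0 := vol_cube_gt0 Q; set V := vol (cube_set Q) in V0 *.
have ifq := integrable_norm_powR mf fq.
have if1 := integrable_powR q1 mf fq.
set a := \int[mu]_(x in cube_set Q) (`|f x| `^ q).
have a0 : 0 <= a by apply: Rintegral_ge0 => x _; exact: powR_ge0.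
have aV0 : 0 <= V^-1 * a by rewrite mulr_ge0// invr_ge0 ltW.
pose B := K * (2 * (V^-1 * a) `^ q^-1).
have B0 : 0 <= B by rewrite !mulr_ge0 ?powR_ge0// ltW.
have BE : B `^ q = (K * 2) `^ q * (V^-1 * a).
  rewrite /B mulrA powRM ?powR_ge0// ?mulr_ge0// ?ltW// -powRrM mulVf ?lt0r_neq0//.
  by rewrite powRr1.
pose P := moment_poly_c s c0 Q f.
(* For a side at least [c0], and for the default value of [xget], the polynomial is 0 and the bound
   is trivial. *)
have PB x : cube_set Q x -> `|peval P x| <= B.
  move=> Qx; rewrite /P /moment_poly_c; case: ifP => _; last first.
    by rewrite peval0 normr0.
  rewrite /moment_poly; case: xgetP => [P' -> Pm|_]; last by rewrite peval0 normr0.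
  apply: (le_trans (HK _ _ _ _ if1 Pm Qx)); rewrite ler_pM2l//.
  exact: mean_le_power_mean.
have pt x : cube_set Q x ->
    `|f x - peval P x| `^ q <= 2 `^ q * (`|f x| `^ q + B `^ q).
  move=> /PB PBx.
  have le2 : `|f x - peval P x| <= 2 * Num.max `|f x| B.
    have := ler_normB (f x) (peval P x).
    have : `|f x| <= Num.max `|f x| B by rewrite le_max lexx.
    have : B <= Num.max `|f x| B by rewrite le_max lexx orbT.
    by lra.
  have mx0 : 0 <= Num.max `|f x| B by rewrite le_max normr_ge0.
  apply: (@le_trans _ _ ((2 * Num.max `|f x| B) `^ q)).
    by rewrite ge0_ler_powR ?nnegrE ?mulr_ge0// ltW.
  rewrite powRM// ler_pM2l ?powR_gt0//.
  have [fx0 Bx0] := (powR_ge0 `|f x| q, powR_ge0 B q).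
  by case: (leP `|f x| B) => _; lra.
have iR : mu.-integrable (cube_set Q)
    (EFin \o (fun x => 2 `^ q * (`|f x| `^ q + B `^ q))).
  exact: (integrableZl mQ _ (integrableD mQ ifq (integrable_cube_cst Q (B `^ q)))).
have intE : \int[mu]_(x in cube_set Q) (2 `^ q * (`|f x| `^ q + B `^ q)) =
    2 `^ q * (1 + (K * 2) `^ q) * a.
  rewrite RintegralZl//; last first.
    exact: (integrableD mQ ifq (integrable_cube_cst Q (B `^ q))).
  rewrite RintegralD//; last exact: integrable_cube_cst.
  rewrite Rintegral_cube_cst BE -/a -[RHS]mulrA; congr (_ * _).
  by rewrite -/V; field; exact: lt0r_neq0.
have le_int : (\int[mu]_(x in cube_set Q) (`|f x - peval P x| `^ q)%:E <=
    (2 `^ q * (1 + (K * 2) `^ q) * a)%:E)%E.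
  rewrite -intE /Rintegral fineK; last exact: integrable_fin_num iR.
  apply: ge0_le_integral => //.
  - apply/measurable_EFinP; apply: measurable_norm_powR.
    apply: measurable_funB => //.
    exact: (measurable_funTS (measurable_peval P)).
  - exact: measurable_int iR.
rewrite /oscillation -/P -poweR_EFin; apply: gt0_ler_poweR.
- by rewrite invr_ge0 ltW.
- rewrite in_itv/= leey andbT mule_ge0//; first by rewrite lee_fin invr_ge0 ltW.
  by apply: integral_ge0 => x _; rewrite lee_fin powR_ge0.
- rewrite in_itv/= leey andbT lee_fin !mulr_ge0 ?powR_ge0// ?addr_ge0 ?powR_ge0//.
  by rewrite invr_ge0 ltW.
- rewrite /average mulrCA EFinM lee_wpmul2l// lee_fin invr_ge0 ltW//.
Qed.

Lemma oscillation_large (q : R) (s : nat) (c0 : R) Q f : c0 <= side Q ->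
  oscillation q s c0 Q f =
  (((vol (cube_set Q))^-1%:E * \int[mu]_(x in cube_set Q) (`|f x| `^ q)%:E)
    `^ q^-1)%E.
Proof.
move=> c0Q; rewrite /oscillation /moment_poly_c ltNge c0Q /=.
congr ((_ * _) `^ _)%E; apply: eq_integral => x _.
by rewrite peval0 subr0.
Qed.

End oscillation_bounds.

(** * Lebesgue spaces and the exhaustion of the whole space by cubes *)

Section lebesgue_spaces.
Context {R : realType} {n : nat}.
Local Notation mu := (lebesgue_Rn R n).
Implicit Types (Q : cube R n) (f : Rn R n -> R) (X : set (Rn R n)).

Lemma Lp_normE (q : R) X f : 0 < q ->
  (Lp_norm q X f = (\int[mu]_(x in X) (`|f x| `^ q)%:E) `^ q^-1)%E.
Proof.
move=> q0; rewrite /Lp_norm unlock; congr (_ `^ _)%E.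
rewrite [RHS]integral_mkcond; apply: eq_integral => x _ /=.
by rewrite !patchE; case: ifP => // _; rewrite normr0 powR0// lt0r_neq0.
Qed.

Lemma Lp_spaceE (q : R) X f : 0 < q -> measurable X ->
  Lp_space q X f <-> measurable_fun X f /\
    (\int[mu]_(x in X) (`|f x| `^ q)%:E < +oo)%E.
Proof.
move=> q0 mX; have qi0 : q^-1 != 0 by rewrite invr_neq0// lt0r_neq0.
have E : (Lp_norm q X f < +oo)%E =
    (\int[mu]_(x in X) (`|f x| `^ q)%:E < +oo)%E.
  by rewrite Lp_normE//; apply/idP/idP => [/(lty_poweRy qi0)|/poweR_lty].
split=> [/andP[/[!inE] mf /= ff]|[mf If]].
  by split; [apply/(measurable_restrictT _ mX)|rewrite -E].
apply/andP; split; rewrite inE/=; first exact/(measurable_restrictT _ mX).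
by move: If; rewrite -E.
Qed.

Lemma Lp_loc_of_Lp (q : R) X f : 0 < q -> measurable X ->
  Lp_space q X f -> Lp_loc q X f.
Proof.
move=> q0 mX /(Lp_spaceE _ q0 mX)[mf If]; split=> // E mE _ EX.
have : Lp_space q E f.
  apply/(Lp_spaceE _ q0 mE); split; first exact: measurable_funS mf.
  apply: le_lt_trans If; apply: (ge0_subset_integral _ mE mX) => //.
  by apply/measurable_EFinP; exact: (measurable_norm_powR q mf).
suff fE : (f \_ E) \_ X = f \_ E by rewrite /Lp_space/= fE.
apply/funext => x; rewrite !patchE.
by case: ifPn => // xX; case: ifPn => // /set_mem/EX/mem_set; rewrite (negbTE xX).
Qed.

Lemma Lp_of_Lp_loc (q : R) X f : measurable X -> bounded_Rn X ->
  Lp_loc q X f -> Lp_space q X f.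
Proof.
move=> mX bX [_ /(_ X mX bX (@subset_refl _ X))].
suff fX : (f \_ X) \_ X = f \_ X by rewrite /Lp_space/= fX.
apply/funext => x; rewrite !patchE.
by case: ifP => // ->.
Qed.

Definition big_cube (k : nat) : cube R n :=
  @Cube R n (nseq_tuple n (- k.+1%:R)) (2 * k.+1%:R)
    (mulr_gt0 (ltr0Sn R 1) (ltr0Sn R k)) (nseq_tuple n false) (nseq_tuple n false).

Lemma big_cubeP k (x : Rn R n) :
  cube_set (big_cube k) x <-> forall i, `|tnth x i| < k.+1%:R.
Proof.
split=> xQ i; have := xQ i; rewrite /big_cube/= !tnth_nseq in_itv/= ltr_norml.
  by move=> /andP[? ?]; apply/andP; split; lra.
by move=> /andP[? ?]; apply/andP; split; lra.
Qed.

Lemma big_cube_bigcup : \bigcup_k cube_set (big_cube k) = [set: Rn R n].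
Proof.
apply/seteqP; split => // x _.
exists (Num.truncn (\sum_(i < n) `|tnth x i|)) => //; apply/big_cubeP => i.
apply: le_lt_trans (truncnS_gt _).
by rewrite (bigD1 i)//= lerDl sumr_ge0.
Qed.

Lemma big_cube_nondecreasing :
  nondecreasing_seq (fun k => cube_set (big_cube k) : set (Rn R n)).
Proof.
move=> k m km; apply/subsetPset => x /big_cubeP xk; apply/big_cubeP => i.
by apply: lt_le_trans (xk i) _; rewrite ler_nat ltnS.
Qed.

(** Monotone convergence along the exhaustion. The bound is required only from [k0] on, because
    cubes used as tests must have side at least [c0]. *)
Lemma integral_le_big_cube (g : Rn R n -> \bar R) (B : \bar R) (k0 : nat) :
  measurable_fun setT g -> (forall x, (0 <= g x)%E) ->
  (forall k, (k0 <= k)%N -> (\int[mu]_(x in cube_set (big_cube k)) g x <= B)%E) ->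
  (\int[mu]_x g x <= B)%E.
Proof.
move=> mg g0 gB; rewrite -big_cube_bigcup.
have cvg_int := @ge0_nondecreasing_set_cvg_integral _ _ _ _ g mu
  big_cube_nondecreasing (fun k => measurable_cube (big_cube k))
  (fun k => measurable_funTS mg) (fun k x _ => g0 x).
rewrite -(cvg_lim _ cvg_int)//; apply: lime_le.
  by apply/cvg_ex; eexists; exact: cvg_int.
by exists k0 => // k /= k0k; exact: gB.
Qed.

(** In dimension 0 every cube has volume 1, so unbounded volumes require [n] to be positive. *)
Lemma vol_big_cube_ge k : (0 < n)%N -> k.+1%:R <= vol (cube_set (big_cube k)).
Proof.
move=> n0; rewrite vol_cube /= -[n]prednK// exprS.
have k1 : 1 <= k.+1%:R :> R by rewrite ler1n.
have : 1 <= (2 * k.+1%:R : R) ^+ n.-1 by rewrite exprn_ege1//; lra.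
by move=> h; rewrite -[leLHS]mulr1 ler_pM//; lra.
Qed.

End lebesgue_spaces.

(** * General lower and upper bounds for the [jn] norm *)

Section jn_bounds.
Context {R : realType} {n : nat}.
Local Notation mu := (lebesgue_Rn R n).
Implicit Types (Q : cube R n) (f : Rn R n -> R) (X : set (Rn R n)).

(** The family consisting of [Q] alone is admissible, and no polynomial is subtracted on it. The
    exponent collects [p^-1] from the weight, [- alpha] from the scaling and [- q^-1] from the
    average. *)
Lemma jn_norm_ge (p q : R) s (alpha c0 : R) X Q f :
  0 < p -> 0 < q -> cube_set Q `<=` X -> c0 <= side Q ->
  ((vol (cube_set Q) `^ (p^-1 - alpha - q^-1))%:E *
     (\int[mu]_(x in cube_set Q) (`|f x| `^ q)%:E) `^ q^-1 <=
   jn_norm p q s alpha c0 X f)%E.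
Proof.
move=> p0 q0 QX c0Q; have V0 := vol_cube_gt0 Q.
have I0 : (0 <= \int[mu]_(x in cube_set Q) (`|f x| `^ q)%:E)%E.
  by apply: integral_ge0 => x _; rewrite lee_fin powR_ge0.
apply: ereal_sup_ubound; exists [set 0%N], (fun=> Q); split.
  by split=> [j _ //|i j -> ->].
rewrite /jn_sum esum_set1; last first.
  by rewrite mule_ge0 ?poweR_ge0// lee_fin ltW.
rewrite oscillation_large//; move: I0.
set V := vol (cube_set Q) in V0 *; set I := (\int[mu]_(x in _) _)%E => I0.
have Vi0 : (0 <= V^-1%:E)%E by rewrite lee_fin invr_ge0 ltW.
have Va0 : (0 <= (V `^ (- alpha))%:E)%E by rewrite lee_fin powR_ge0.
rewrite (poweRM _ Vi0 I0) poweRM ?poweR_ge0 ?lee_fin ?(ltW V0)//.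
rewrite -(poweRrM _ p p^-1) mulfV ?lt0r_neq0// poweRe1; last first.
  by rewrite !mule_ge0// ?poweR_ge0.
rewrite !muleA !poweR_EFin -!EFinM; congr (_%:E * _)%E.
rewrite -(powR_inv1 (ltW V0)) -powRrM mulN1r.
have D a b : V `^ (a + b) = V `^ a * V `^ b.
  by apply: powRD; rewrite (lt0r_neq0 V0) implybT.
by rewrite !D -mulrA.
Qed.

(** The density [g] dominates each summand by an integral over its own cube; summing over cubes with
    disjoint interiors leaves at most the integral over [X]. *)
Lemma jn_norm_le (p q : R) s (c0 : R) X f (g : Rn R n -> R) (B : R) :
  0 < p -> measurable X -> measurable_fun X g -> (forall x, X x -> 0 <= g x) ->
  (forall Q, cube_set Q `<=` X ->
    ((vol (cube_set Q))%:E * oscillation q s c0 Q f `^ p <=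
      \int[mu]_(x in cube_set Q) (g x)%:E)%E) ->
  (\int[mu]_(x in X) (g x)%:E <= B%:E)%E ->
  (jn_norm p q s 0 c0 X f <= (B `^ p^-1)%:E)%E.
Proof.
move=> p0 mX mg g0 Qg gB; apply: ge_ereal_sup => _ [J [Q [[JX Jdisj] ->]]].
have sum_ge0 : (0 <= jn_sum p q s 0 c0 J Q f)%E.
  apply: esum_ge0 => j _; rewrite mule_ge0 ?poweR_ge0// lee_fin.
  by rewrite ltW// vol_cube_gt0.
have sum_le : (jn_sum p q s 0 c0 J Q f <= B%:E)%E.
  apply: le_trans gB.
  apply: le_trans (esum_cube_family (g := EFin \o g) mX _ _ (conj JX Jdisj)).
  - apply: le_esum => j Jj; rewrite oppr0 powRr0 mul1e.
    exact/Qg/JX.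
  - exact/measurable_EFinP.
  - by move=> x Xx; rewrite lee_fin g0.
rewrite -poweR_EFin; apply: gt0_ler_poweR => //.
- by rewrite invr_ge0 ltW.
- by rewrite in_itv/= leey andbT.
- by rewrite in_itv/= leey andbT (le_trans sum_ge0).
Qed.

Lemma oscillation_term_le (p q : R) (s : nat) : 0 < p -> 1 <= q ->
  exists2 C : R, 0 < C & forall (c0 : R) Q f, measurable_fun (cube_set Q) f ->
    (\int[mu]_(x in cube_set Q) (`|f x| `^ q)%:E < +oo)%E ->
    ((vol (cube_set Q))%:E * oscillation q s c0 Q f `^ p <=
     (vol (cube_set Q) * (C * ((vol (cube_set Q))^-1 *
       \int[mu]_(x in cube_set Q) (`|f x| `^ q))) `^ (p / q))%:E)%E.
Proof.
move=> p0 q1; have [C C0 HC] := @oscillation_le R n q s q1.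
exists C => // c0 Q f mf fq; have V0 := vol_cube_gt0 Q.
rewrite EFinM lee_wpmul2l ?lee_fin ?(ltW V0)//.
rewrite [p / q]mulrC powRrM -[leRHS]poweR_EFin.
have HCQ := HC c0 Q f mf fq.
apply: (gt0_ler_poweR (ltW p0)) HCQ.
- by rewrite in_itv/= leey andbT poweR_ge0.
- by rewrite in_itv/= leey andbT lee_fin powR_ge0.
Qed.

Lemma powR_le_add1 (z t : R) : 0 <= z -> 0 <= t <= 1 -> z `^ t <= 1 + z.
Proof.
move=> z0 /andP[t0 t1]; have [z1|z1] := leP z 1.
  have : z `^ t <= 1 `^ t by rewrite ge0_ler_powR ?nnegrE.
  by rewrite powR1 => /le_trans; apply; rewrite lerDl.
by rewrite ler_wpDl// ler1_powR// ltW.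
Qed.

(** With [z = (a / A) / (v / V)] the claim reduces to [z ^ t <= 1 + z]. It replaces Hölder's
    inequality over the cubes: the right side is additive in [(v, a)], so over disjoint pieces it
    sums to at most twice the value for the whole. *)
Lemma Holder_term (v V a A C t : R) : 0 < v -> 0 < V -> 0 <= a <= A -> 0 < C ->
  0 < t <= 1 ->
  v * (C * (v^-1 * a)) `^ t <= V * (C * (V^-1 * A)) `^ t * (v / V + a / A).
Proof.
move=> v0 V0 /andP[a0 aA] C0 /andP[t0 t1].
have A0 : 0 <= A by exact: le_trans aA.
(* If [A] vanishes then so does [a], and both sides are 0 because [t > 0]. *)
have [AE|An0] := eqVneq A 0.
  have -> : a = 0 by apply/eqP; rewrite eq_le a0 -AE aA.
  by rewrite AE !mulr0 powR0 ?lt0r_neq0// !mulr0 mul0r.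
have Agt0 : 0 < A by rewrite lt_neqAle eq_sym An0.
pose z := (a / A) / (v / V).
have z0 : 0 <= z by rewrite !divr_ge0// ltW.
have -> : C * (v^-1 * a) = (C * (V^-1 * A)) * z.
  by rewrite /z; field; rewrite !lt0r_neq0.
have -> : v / V + a / A = v / V * (1 + z).
  by rewrite /z; field; rewrite !lt0r_neq0.
rewrite powRM//; last by rewrite !mulr_ge0// ?invr_ge0 ltW.
rewrite [leRHS](_ : _ = v * ((C * (V^-1 * A)) `^ t * (1 + z))); last first.
  by field; exact: lt0r_neq0.
rewrite ler_wpM2l ?(ltW v0)// ler_wpM2l ?powR_ge0//.
by apply: powR_le_add1 => //; rewrite t1 ltW.
Qed.

End jn_bounds.

(** * Norm comparisons on a cube and on the whole space, and the trivial range of [alpha] *)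

Section proposition_parts.
Context {R : realType} {n : nat}.
Local Notation mu := (lebesgue_Rn R n).
Implicit Types (Q : cube R n) (f : Rn R n -> R) (X : set (Rn R n)).

Lemma integral_EFin_Rintegral (D : set (Rn R n)) (g : Rn R n -> R) :
  measurable D -> mu.-integrable D (EFin \o g) ->
  (\int[mu]_(x in D) (g x)%:E = (\int[mu]_(x in D) g x)%:E)%E.
Proof. by move=> mD ig; rewrite /Rintegral fineK//; exact: integrable_fin_num ig. Qed.

Lemma Lp_space_sub (q : R) X Q f : 0 < q -> measurable X -> cube_set Q `<=` X ->
  Lp_space q X f -> Lp_space q (cube_set Q) f.
Proof.
move=> q0 mX QX /(Lp_spaceE _ q0 mX)[mf If]; have mQ := measurable_cube Q.
apply/(Lp_spaceE _ q0 mQ); split; first exact: measurable_funS mf.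
apply: le_lt_trans If; apply: (ge0_subset_integral _ mQ mX) => //.
by apply/measurable_EFinP; exact: (measurable_norm_powR q mf).
Qed.

Lemma jn_norm_cube_le (p q : R) (s : nat) : 1 < p -> p <= q ->
  exists2 C : R, 0 < C & forall (c0 : R) Q0 f, Lp_space q (cube_set Q0) f ->
    ((vol (cube_set Q0) `^ (q^-1 - p^-1))%:E * jn_norm p q s 0 c0 (cube_set Q0) f <=
     C%:E * Lp_norm q (cube_set Q0) f)%E.
Proof.
move=> p1 pq; have q1 : 1 <= q by exact: le_trans (ltW p1) pq.
have p0 : 0 < p by exact: lt_trans p1.
have q0 : 0 < q by exact: lt_le_trans pq.
have [C C0 HC] := @oscillation_term_le R n p q s p0 q1.
exists (C `^ q^-1 * 2 `^ p^-1); first by rewrite mulr_gt0// powR_gt0.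
move=> c0 Q0 f f_Lp; have mQ0 := measurable_cube Q0.
have [mf fq] := (Lp_spaceE f q0 mQ0).1 f_Lp.
have V0 := vol_cube_gt0 Q0; set V := vol (cube_set Q0) in V0 *.
pose A := \int[mu]_(x in cube_set Q0) (`|f x| `^ q).
have A0 : 0 <= A by apply: Rintegral_ge0 => x _; exact: powR_ge0.
(* The bound on the summand of [Q0] itself. The density [g] spreads [D] once proportionally to
   volume and once proportionally to [|f| ^ q], so its integral over [Q0] is at most [2 * D]. *)
pose D := V * (C * (V^-1 * A)) `^ (p / q).
have D0 : 0 <= D by rewrite mulr_ge0 ?powR_ge0// ltW.
pose g (x : Rn R n) := D / V + D / A * `|f x| `^ q.
have g_int Q : cube_set Q `<=` cube_set Q0 ->
    (\int[mu]_(x in cube_set Q) (g x)%:E = (D * (vol (cube_set Q) / V +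
      (\int[mu]_(x in cube_set Q) (`|f x| `^ q)) / A))%:E)%E.
  move=> QX; have mQ := measurable_cube Q.
  have [mfQ fqQ] := (Lp_spaceE f q0 mQ).1 (Lp_space_sub q0 mQ0 QX f_Lp).
  have ifq := integrable_norm_powR mfQ fqQ.
  have i2 := integrableZl mQ (D / A) ifq.
  rewrite integral_EFin_Rintegral//; last first.
    exact: (integrableD mQ (integrable_cube_cst Q (D / V)) i2).
  congr EFin; rewrite RintegralD//; last exact: integrable_cube_cst.
  rewrite (RintegralZl (D / A) mQ ifq) Rintegral_cube_cst mulrDr.
  by congr (_ + _); rewrite mulrAC mulrA.
have jn_le : (jn_norm p q s 0 c0 (cube_set Q0) f <= ((D * 2) `^ p^-1)%:E)%E.
  apply: (jn_norm_le (g := g)) => //.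
  - apply: measurable_funD; first exact: measurable_cst.
    apply: measurable_funM; first exact: measurable_cst.
    exact: measurable_norm_powR.
  - have [DV0 DA0] := (divr_ge0 D0 (ltW V0), divr_ge0 D0 A0).
    by move=> x _; rewrite addr_ge0// mulr_ge0// powR_ge0.
  - move=> Q QX; have mQ := measurable_cube Q.
    have [mfQ fqQ] := (Lp_spaceE f q0 mQ).1 (Lp_space_sub q0 mQ0 QX f_Lp).
    rewrite g_int//; apply: (le_trans (HC c0 Q f mfQ fqQ)); rewrite lee_fin.
    apply: Holder_term => //; first exact: vol_cube_gt0.
      apply/andP; split; first by apply: Rintegral_ge0 => x _; exact: powR_ge0.
      rewrite -lee_fin -!integral_EFin_Rintegral//; last 2 first.
      - exact: integrable_norm_powR.
      - exact: integrable_norm_powR.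
      apply: (ge0_subset_integral _ mQ mQ0) => //.
      by apply/measurable_EFinP; exact: (measurable_norm_powR q mf).
    by rewrite divr_gt0// ler_pdivrMr// mul1r.
  - rewrite g_int// lee_fin -/V -/A ler_wpM2l// divff ?lt0r_neq0// -natr1 addrC lerD2r.
    (* [A / A] is 1, or 0 by convention when [A = 0]. *)
    have [->|An0] := eqVneq A 0; first by rewrite mul0r.
    by rewrite divff.
apply: (le_trans (lee_wpmul2l _ jn_le)); first by rewrite lee_fin powR_ge0.
rewrite Lp_normE// integral_EFin_Rintegral//; last exact: integrable_norm_powR.
rewrite poweR_EFin -!EFinM lee_fin -/A /D.
have Vi0 : 0 <= V^-1 by rewrite invr_ge0 ltW.
have VA0 : 0 <= V^-1 * A by rewrite mulr_ge0.
have CVA0 : 0 <= C * (V^-1 * A) by rewrite mulr_ge0// ltW.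
(* Expanding [(D * 2) ^ p^-1], all powers of [V] cancel against the weight, leaving
   [C ^ q^-1 * 2 ^ p^-1 * A ^ q^-1]. *)
rewrite (powRM _ (mulr_ge0 (ltW V0) (powR_ge0 _ _)))//.
rewrite (powRM _ (ltW V0) (powR_ge0 _ _)) -(powRrM _ (p / q) p^-1).
rewrite (_ : p / q * p^-1 = q^-1); last by field; rewrite !lt0r_neq0.
rewrite (powRM _ (ltW C0) VA0) (powRM _ Vi0 A0).
rewrite powRB; last by rewrite (lt0r_neq0 V0) implybT.
rewrite -(powR_inv1 (ltW V0)) -(powRrM V (-1)) mulN1r powRN.
have Vp0 := powR_gt0 p^-1 V0; have Vq0 := powR_gt0 q^-1 V0.
rewrite le_eqVlt; apply/orP; left; apply/eqP; field.
by rewrite !lt0r_neq0.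
Qed.

(** Testing with [Q0] itself; the weight cancels the power of the volume. *)
Lemma Lp_norm_cube_le (p q : R) (s : nat) (c0 : R) Q0 f :
  0 < p -> 0 < q -> c0 <= side Q0 ->
  (Lp_norm q (cube_set Q0) f <= (vol (cube_set Q0) `^ (q^-1 - p^-1))%:E *
     jn_norm p q s 0 c0 (cube_set Q0) f)%E.
Proof.
move=> p0 q0 c0Q; have V0 := vol_cube_gt0 Q0.
have := @jn_norm_ge R n p q s 0 c0 _ Q0 f p0 q0 (@subset_refl _ _) c0Q.
have W0 : (0 <= (vol (cube_set Q0) `^ (q^-1 - p^-1))%:E)%E.
  by rewrite lee_fin powR_ge0.
move=> /(lee_wpmul2l W0); apply: le_trans.
rewrite muleA -EFinM -powRD; last by rewrite (lt0r_neq0 V0) implybT.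
rewrite (_ : _ + _ = 0); last by ring.
by rewrite powRr0 mul1e Lp_normE.
Qed.

(** For equal exponents the volume drops out of each summand, which is at most the integral of
    [C * |f| ^ p] over its cube. This density is integrable although the whole space may have
    infinite measure. *)
Lemma jn_norm_Rn_le (p : R) (s : nat) : 1 < p ->
  exists2 C : R, 0 < C & forall (c0 : R) f, Lp_space p [set: Rn R n] f ->
    (jn_norm p p s 0 c0 [set: Rn R n] f <= C%:E * Lp_norm p [set: Rn R n] f)%E.
Proof.
move=> p1; have p0 : 0 < p by exact: lt_trans p1.
have [C C0 HC] := @oscillation_term_le R n p p s p0 (ltW p1).
exists (C `^ p^-1); first by rewrite powR_gt0.
move=> c0 f f_Lp.
have [mf fq] := (Lp_spaceE f p0 measurableT).1 f_Lp.
have ifp : mu.-integrable setT (EFin \o (fun x => `|f x| `^ p)).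
  apply/integrableP; split.
    by apply/measurable_EFinP; exact: measurable_norm_powR.
  by under eq_integral do rewrite /= ger0_norm ?powR_ge0//.
have A0 : 0 <= \int[mu]_x (`|f x| `^ p).
  by apply: Rintegral_ge0 => x _; exact: powR_ge0.
rewrite Lp_normE// integral_EFin_Rintegral// poweR_EFin -EFinM.
rewrite -powRM ?(ltW C0)//.
apply: (jn_norm_le (g := fun x => C * `|f x| `^ p)) => //.
- apply: measurable_funM; first exact: measurable_cst.
  exact: measurable_norm_powR.
- by move=> x _; rewrite mulr_ge0 ?powR_ge0// ltW.
- move=> Q QX; have mQ := measurable_cube Q.
  have [mfQ fpQ] := (Lp_spaceE f p0 mQ).1 (Lp_space_sub p0 measurableT QX f_Lp).
  apply: (le_trans (HC c0 Q f mfQ fpQ)).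
  have ifQ := integrable_norm_powR mfQ fpQ.
  rewrite integral_EFin_Rintegral//; last exact: (integrableZl mQ C ifQ).
  rewrite RintegralZl// lee_fin divff ?lt0r_neq0// powRr1; last first.
    rewrite mulr_ge0 ?(ltW C0)// mulr_ge0// ?invr_ge0 ?(ltW (vol_cube_gt0 Q))//.
    by apply: Rintegral_ge0 => x _; exact: powR_ge0.
  by rewrite mulrCA mulVKf// lt0r_neq0// vol_cube_gt0.
- rewrite integral_EFin_Rintegral//; last exact: (integrableZl measurableT C ifp).
  by rewrite RintegralZl.
Qed.

Lemma integral_big_cube_le (p q : R) (s : nat) (alpha c0 : R) f (k : nat) :
  0 < p -> 0 < q -> c0 <= k.+1%:R ->
  ((vol (cube_set (@big_cube R n k)) `^ (p^-1 - alpha - q^-1))%:E *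
     (\int[mu]_(x in cube_set (big_cube k)) (`|f x| `^ q)%:E) `^ q^-1 <=
   jn_norm p q s alpha c0 [set: Rn R n] f)%E.
Proof.
move=> p0 q0 c0k; apply: jn_norm_ge => //.
by apply: (le_trans c0k); rewrite /= ler_peMl// ler1n.
Qed.

(** For equal exponents and [alpha = 0] the volume exponent is 0, so the single-cube bounds are
    uniform in [k] and pass to the limit. *)
Lemma Lp_norm_Rn_le (p : R) (s : nat) (c0 : R) f : 0 < p ->
  measurable_fun [set: Rn R n] f ->
  (Lp_norm p [set: Rn R n] f <= jn_norm p p s 0 c0 [set: Rn R n] f)%E.
Proof.
move=> p0 mf; rewrite Lp_normE//.
set N := jn_norm _ _ _ _ _ _ _.
have I0 X : (0 <= \int[mu]_(x in X) (`|f x| `^ p)%:E)%E.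
  by apply: integral_ge0 => x _; rewrite lee_fin powR_ge0.
have pp x : (0 <= x)%E -> ((x `^ p^-1) `^ p = x)%E.
  by move=> x0; rewrite -poweRrM mulVf ?lt0r_neq0// poweRe1.
have IN k : (Num.truncn c0 <= k)%N ->
    (\int[mu]_(x in cube_set (@big_cube R n k)) (`|f x| `^ p)%:E <= N `^ p)%E.
  move=> c0k.
  have := @integral_big_cube_le p p s 0 c0 f k p0 p0.
  rewrite subr0 subrr powRr0 mul1e -/N => IN.
  rewrite -(pp _ (I0 _)); apply: (gt0_ler_poweR (ltW p0)).
  - by rewrite in_itv/= leey andbT poweR_ge0.
  - rewrite in_itv/= leey andbT; apply: le_trans (IN _); first exact: poweR_ge0.
    by apply: ltW (lt_le_trans (truncnS_gt _) _); rewrite ler_nat.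
  - by apply/IN/ltW/(lt_le_trans (truncnS_gt _)); rewrite ler_nat.
have N0 : (0 <= N)%E.
  apply: le_trans (@integral_big_cube_le p p s 0 c0 f (Num.truncn c0) p0 p0 _).
    by rewrite mule_ge0 ?poweR_ge0// lee_fin powR_ge0.
  exact/ltW/truncnS_gt.
have : (\int[mu]_x (`|f x| `^ p)%:E <= N `^ p)%E.
  apply: integral_le_big_cube IN.
  - by apply/measurable_EFinP; exact: measurable_norm_powR.
  - by move=> x; rewrite lee_fin powR_ge0.
move=> le1; rewrite -[leRHS]poweRe1// -(mulfV (lt0r_neq0 p0)) poweRrM.
apply: gt0_ler_poweR => //.
- by rewrite invr_ge0 ltW.
- by rewrite in_itv/= leey andbT.
- by rewrite in_itv/= leey andbT poweR_ge0.
Qed.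

Lemma jn_Rn_trivial (p q : R) (s : nat) (alpha c0 : R) f : (0 < n)%N ->
  0 < p -> 0 < q -> alpha < p^-1 - q^-1 ->
  measurable_fun [set: Rn R n] f ->
  (jn_norm p q s alpha c0 [set: Rn R n] f < +oo)%E ->
  {ae mu, forall x, f x = 0}.
Proof.
move=> n0 p0 q0 alt mf; set N := jn_norm _ _ _ _ _ _ _ => Noo.
have gam0 : 0 < p^-1 - alpha - q^-1 by lra.
set gam := p^-1 - alpha - q^-1 in gam0.
have mfq : measurable_fun setT (fun x => (`|f x| `^ q)%:E).
  by apply/measurable_EFinP; exact: measurable_norm_powR.
have I0 X : (0 <= \int[mu]_(x in X) (`|f x| `^ q)%:E)%E.
  by apply: integral_ge0 => x _; rewrite lee_fin powR_ge0.
have IN k : c0 <= k.+1%:R -> ((vol (cube_set (@big_cube R n k)) `^ gam)%:E *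
   (\int[mu]_(x in cube_set (big_cube k)) (`|f x| `^ q)%:E) `^ q^-1 <= N)%E.
  exact: integral_big_cube_le.
have N0 : (0 <= N)%E.
  apply: le_trans (IN (Num.truncn c0) _); last exact/ltW/truncnS_gt.
  by rewrite mule_ge0 ?poweR_ge0// lee_fin powR_ge0.
have Nfin : N \is a fin_num by rewrite ge0_fin_numE.
have small (e : R) : 0 < e -> (\int[mu]_x (`|f x| `^ q)%:E <= e%:E)%E.
  move=> e0; pose d := e `^ q^-1; have d0 : 0 < d by rewrite powR_gt0.
  (* Beyond [M] the cube has side at least [c0] and its volume to the power [gam] is at least
     [N / d], which forces its [L^q] norm below [d], that is, the integral below [e]. *)
  pose M := Num.max c0 ((fine N / d) `^ gam^-1).
  apply: (integral_le_big_cube (k0 := Num.truncn M)) => // k Mk.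
  have kM : M <= k.+1%:R.
    by apply: ltW (lt_le_trans (truncnS_gt _) _); rewrite ler_nat.
  have c0k : c0 <= k.+1%:R by apply: le_trans kM; rewrite le_max lexx.
  have Nd0 : 0 <= fine N / d by rewrite divr_ge0 ?fine_ge0// ltW.
  have Vk : fine N / d <= vol (cube_set (@big_cube R n k)) `^ gam.
    rewrite -[leLHS]powRr1// -(mulVf (lt0r_neq0 gam0)) powRrM.
    rewrite ge0_ler_powR ?nnegrE ?powR_ge0 ?(ltW gam0)//.
      exact/ltW/vol_cube_gt0.
    apply: le_trans (vol_big_cube_ge k n0).
    by apply: le_trans kM; rewrite le_max lexx orbT.
  have V0 : 0 < vol (cube_set (@big_cube R n k)) `^ gam.
    by rewrite powR_gt0// vol_cube_gt0.
  have : ((\int[mu]_(x in cube_set (@big_cube R n k)) (`|f x| `^ q)%:E) `^ q^-1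
      <= d%:E)%E.
    rewrite -(lee_pmul2l (x := (vol (cube_set (@big_cube R n k)) `^ gam)%:E))//.
    apply: (le_trans (IN k c0k)); rewrite -(fineK Nfin) -EFinM lee_fin.
    by rewrite -ler_pdivrMr.
  have qE x : (0 <= x)%E -> ((x `^ q^-1) `^ q = x)%E.
    by move=> x0; rewrite -poweRrM mulVf ?lt0r_neq0// poweRe1.
  move=> Id; rewrite -[leLHS]qE// -[leRHS]qE ?lee_fin ?(ltW e0)//.
  apply: (gt0_ler_poweR (ltW q0)) Id.
  - by rewrite in_itv/= leey andbT poweR_ge0.
  - by rewrite in_itv/= leey andbT lee_fin ltW.
have int0 : (\int[mu]_x (`|f x| `^ q)%:E = 0)%E.
  apply/eqP; rewrite eq_le I0 andbT; apply/lee_addgt0Pr => e e0.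
  by rewrite add0e; exact: small.
have : (Lp_norm q [set: Rn R n] f = 0)%E.
  by rewrite Lp_normE// int0 poweR0r// invr_neq0// lt0r_neq0.
have mEf : measurable_fun setT (EFin \o f) by exact/measurable_EFinP.
have qE0 : (0 < q%:E)%E by rewrite lte_fin.
rewrite /Lp_norm patch_setT => /(Lnorm_eq0_eq0 mEf qE0).
by apply: filterS => x /(_ I) [].
Qed.

End proposition_parts.

Theorem proposition3p4 (R : realType) (n s : nat) (n_gt0 : (0 < n)%N) :
  (forall p q : R, 1 < p -> p <= q ->
    exists c C : R, [/\ 0 < c, 0 < C &
      forall (Q0 : cube R n) (c0 : R), 0 < c0 -> c0 < side Q0 ->
        equal_with_norm_bounds c C
          (scaled_space (vol (cube_set Q0) `^ (q^-1 - p^-1))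
             (jn p q s 0 c0 (cube_set Q0)))
          (Lp q (cube_set Q0))])
  /\
  (forall p c0 : R, 1 < p -> 0 < c0 ->
    exists c C : R, [/\ 0 < c, 0 < C &
      equal_with_norm_bounds c C
        (jn p p s 0 c0 [set: Rn R n]) (Lp p [set: Rn R n])])
  /\
  (forall (p q alpha c0 : R) (f : Rn R n -> R),
    1 < p -> p < q -> 0 <= alpha -> alpha < p^-1 - q^-1 -> 0 < c0 ->
    carrier (jn p q s alpha c0 [set: Rn R n]) f ->
    {ae lebesgue_Rn R n, forall x, f x = 0}).
Proof.
move: n_gt0 => n0; split; [|split].
- move=> p q p1 pq; have p0 : 0 < p by exact: lt_trans p1.
  have q0 : 0 < q by exact: lt_le_trans pq.
  have [C C0 HC] := @jn_norm_cube_le R n p q s p1 pq.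
  (* Both constants are fixed before [Q0] and [c0], so the equivalence is uniform in them. *)
  exists 1, C; split => // Q0 c0 _ c0Q; have mQ := measurable_cube Q0.
  have W0 : 0 < vol (cube_set Q0) `^ (q^-1 - p^-1).
    by rewrite powR_gt0// vol_cube_gt0.
  have jn_Lp : jn_space p q s 0 c0 (cube_set Q0) = Lp_space q (cube_set Q0).
    apply/seteqP; split=> f.
      (* A cube is bounded, so local integrability on it is already global. *)
      by move=> [f_loc _]; apply: Lp_of_Lp_loc f_loc => //; exact: bounded_cube.
    move=> f_Lp; split; first exact: Lp_loc_of_Lp.
    have := HC c0 Q0 f f_Lp.
    move: f_Lp => /(Lp_spaceE _ q0 mQ)[_ fq].
    have : (C%:E * Lp_norm q (cube_set Q0) f < +oo)%E.
      by rewrite lte_mul_pinfty ?lee_fin ?(ltW C0)// Lp_normE// poweR_lty.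
    move=> /[swap] /le_lt_trans /[apply].
    (* The weight is positive, so an infinite [jn] norm would make the weighted norm infinite
       too. *)
    by case: (jn_norm _ _ _ _ _ _ _) => [r|/=|//]; rewrite ?ltry ?gt0_muley.
  split=> // f [f_loc f_jn]; split; last first.
    by apply: HC; rewrite -jn_Lp.
  by rewrite mul1e; apply: Lp_norm_cube_le => //; exact: ltW.
- move=> p c0 p1 c00; have p0 : 0 < p by exact: lt_trans p1.
  have [C C0 HC] := @jn_norm_Rn_le R n p s p1.
  exists 1, C; split => //.
  have jn_Lp : jn_space p p s 0 c0 [set: Rn R n] = Lp_space p [set: Rn R n].
    apply/seteqP; split=> f.
      (* Unlike on a cube, global integrability here rests on the finiteness of the [jn] norm. *)
      move=> [[mf _] f_jn]; apply/(Lp_spaceE _ p0 measurableT); split => //.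
      have /le_lt_trans := @Lp_norm_Rn_le R n p s c0 f p0 mf.
      move=> /(_ _ f_jn); rewrite Lp_normE// => /lty_poweRy; apply.
      by rewrite invr_neq0// lt0r_neq0.
    move=> f_Lp; split; first exact: Lp_loc_of_Lp.
    apply: le_lt_trans (HC c0 f f_Lp) _.
    move: f_Lp => /(Lp_spaceE _ p0 measurableT)[_ fq].
    by rewrite lte_mul_pinfty ?lee_fin ?(ltW C0)// Lp_normE// poweR_lty.
  split=> // f [f_loc f_jn]; split; last first.
    by apply: HC; rewrite -jn_Lp.
  by rewrite mul1e; apply: Lp_norm_Rn_le => //; case: f_loc.
- move=> p q alpha c0 f p1 pq alpha0 alt c00 [[mf _] f_jn].
  have p0 : 0 < p by exact: lt_trans p1.
  exact: (jn_Rn_trivial n0 p0 (lt_trans p0 pq) alt mf f_jn).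
Qed.
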